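(* Let $0<p\le 1$ and let $L_n$ be the number of items retained by the $p$-percentile rule after $n$ items have been observed. Then $L_n/(n+1)^p$, $n\ge1$, is a submartingale (with respect to $(\mathcal{F}_n)$) that converges almost surely as $n\to\infty$ to a nondegenerate finite random variable $\Lambda$, and $\lim_{n\to\infty}E\big(L_n/(n+1)^p\big)=E\Lambda=c_p$, where $c_p=\lim_{n\to\infty}E(L_n)/n^p$.
   Context: $X_1,X_2,\ldots$ are i.i.d. real random variables with a continuous distribution. Smaller values are better; $R_i^n=\sum_{j=1}^n I\{X_j\le X_i\}$ is the rank of $X_i$ among $X_1,\ldots,X_n$. $\mathcal{F}_n$ is the $\sigma$-field generated by the ranks of $X_1,\ldots,X_n$. For fixed $0<p\le1$ the $p$-percentile rule retains items as follows: $L_0=0$ and the first item is retained ($L_1=1$); for $n\ge 2$, $X_n$ is retained if and only if $R_n^n\le\lceil pL_{n-1}\rceil$, where $L_{n}$ denotes the number of items retained among the first $n$. The limit $c_p=\lim_{n\to\infty} E(L_n)/n^p$ exists and satisfies $0<c_p<\infty$. ''Nondegenerate'' means not almost surely equal to a constant. *)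

(* Defs.v *)
From HB Require Import structures.
From mathcomp Require Import all_boot all_order all_algebra finmap.
From mathcomp Require Import all_classical all_reals all_analysis.

Set Implicit Arguments.
Unset Strict Implicit.
Unset Printing Implicit Defensive.

Import Order.TTheory GRing.Theory Num.Theory.
Import numFieldNormedType.Exports.

Local Open Scope classical_set_scope.
Local Open Scope ring_scope.

Section Percentile.
Context {R : realType}.
Implicit Types (x : nat -> R) (p : R) (n i : nat).

(* Sequences are indexed from 0: [x i] is the (i+1)-st item, so [rank x n i]
   is its rank R_{i+1}^n among the first n items. *)
Definition rank x n i : nat := (\sum_(j < n) (x j <= x i)%R)%N.

(* [retained p x n] is L_n; the item added at step [m.+1] is [x m]. *)
Fixpoint retained p x n : nat :=
  if n is m.+1 then
    (retained p x m +
     ((m == 0) ||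
      ((rank x m.+1 m)%:Z <= Num.ceil (p * (retained p x m)%:R))%R))%N
  else 0%N.

End Percentile.

Section Probability.
Context d (T : measurableType d) (R : realType) (P : probability T R).
Local Open Scope ereal_scope.

Definition mutually_independent (I : choiceType) (X : I -> {RV P >-> R}) :=
  forall (J : {fset I}) (B : I -> set R), (forall i, measurable (B i)) ->
    P (\bigcap_(i in [set` J]) (X i @^-1` B i)) =
    \prod_(i <- J) P (X i @^-1` B i).

Definition identically_distributed (I : Type) (X : I -> {RV P >-> R}) :=
  forall i j (B : set R), measurable B ->
    distribution P (X i) B = distribution P (X j) B.

Definition filtration (F : nat -> set_system T) :=
  [/\ forall n, sigma_algebra [set: T] (F n),
      forall n, F n `<=` measurable &
      forall m n, (m <= n)%N -> F m `<=` F n].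

Definition measurable_wrt (G : set_system T) (Y : T -> R) :=
  preimage_set_system [set: T] Y measurable `<=` G.

(* [Z] is a version of the conditional expectation of [Y] given [G]. *)
Definition is_cond_expectation (G : set_system T) (Y Z : T -> R) :=
  [/\ measurable_wrt G Z,
      P.-integrable [set: T] (EFin \o Z) &
      forall A, G A -> \int[P]_(w in A) (Z w)%:E = \int[P]_(w in A) (Y w)%:E].

Definition submartingale (F : nat -> set_system T) (M : nat -> T -> R) :=
  [/\ filtration F,
      forall n, measurable_wrt (F n) (M n),
      forall n, P.-integrable [set: T] (EFin \o M n) &
      forall n, exists2 Z, is_cond_expectation (F n) (M n.+1) Z &
                           {ae P, forall w, (M n w <= Z w)%R}].

Definition not_ae_constant (Y : T -> R) :=
  ~ exists c : R, {ae P, forall w, Y w = c}.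

(* The sigma-field generated by the ranks among the first n items; the
   measurable structure of [nat] is the discrete one. *)
Definition rank_field (X : nat -> {RV P >-> R}) n : set_system T :=
  g_sigma_preimage (fun (i : 'I_n) w => rank (fun k => X k w) n i).

Definition num_retained (p : R) (X : nat -> {RV P >-> R}) n (w : T) : R :=
  (retained p (fun k => X k w) n)%:R.

End Probability.

(* Main.v *)
(** Conditionally on the relative order of the first [n] items, the rank of
    the next one is uniform on [1, ..., n + 1]: exchanging it with the item of
    the adjacent rank preserves the law of the sequence and the order of the
    first [n] items, so two adjacent ranks are equally likely.  Hence
    [E(L_(n+1) | F_n) = L_n + ceil(p L_n) / (n + 1)], and everything is compared
    with [b_n = prod_(k <= n) (1 + p / k)], which is of exact order [(n + 1)^p].
    Bernoulli's inequality gives the submartingale property.  For convergence no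
    martingale theorem is needed: [E (L_n / b_n - L_m / b_m)^2 = O(1 / b_m)], so
    the increments of [L_n / b_n] along [n_k = (k + 2)^e - 1] are summable in L^1
    for large [e], and since [L_n] is nondecreasing and [n_(k+1) / n_k] tends to
    [1], the whole sequence follows.  The limit is not constant: given [L_m = 1]
    the supermartingale [(L_n + 1/p) / b_n] bounds its conditional mean by
    [O(1 / b_m)], whereas its mean is positive. *)

Require Import Defs.
From HB Require Import structures.
From mathcomp Require Import all_boot all_order all_algebra perm finmap.
From mathcomp Require Import all_classical all_reals all_analysis.
From mathcomp Require Import measurable_realfun ring lra.

Set Implicit Arguments.
Unset Strict Implicit.
Unset Printing Implicit Defensive.

Import Order.TTheory GRing.Theory Num.Theory.
Import numFieldNormedType.Exports.

Local Open Scope classical_set_scope.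
Local Open Scope ring_scope.

(** * The normalizing sequence *)

Section Growth.
Context {R : realType}.
Implicit Types (p u : R) (n m k : nat).

(** The rank field is the family of sets saturated under [same_ranks], so conditioning on it is a
    finite sum over rank patterns. The exchange argument needs a fixed transposition, whereas the
    item adjacent to the new one depends on the outcome; hence events are split according to that
    item. What keeps [L_n / b_n] from being a martingale is the rounding by the ceiling, which adds
    at most [1 / (n + 1)] to the drift. Divided by [b_(n+1)] these errors telescope to [O(1 / b_m)],
    and adding [1 / p] to [L_n] absorbs them altogether. The dominating function is built from the
    gaps along the times [n_k], so dominated convergence is applied along these times only. The full
    sequence of means converges for another reason: [E L_n / b_n] is nondecreasing from [n = 1] on
    and at most [1 / p]. Passing from [b_n] to [(n + 1)^p] multiplies limits by the positive limit
    of [b_n / (n + 1)^p]. *)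

Lemma powR_le_tangent p u : 0 <= p <= 1 -> 0 < u -> u `^ p <= 1 + p * (u - 1).
Proof.
move=> /andP[p0 p1] u0; set a := 1 + p * (u - 1).
have a0 : 0 < a.
  have -> : a = p * u + (1 - p) by rewrite /a; ring.
  move: p0; rewrite le_eqVlt => /predU1P[<-|p0]; first by lra.
  by rewrite ltr_pwDl ?mulr_gt0 ?subr_ge0.
have ln_le (x : R) : 0 < x -> ln x <= x - 1.
  by move=> x0; rewrite -{1}(subrK 1 x) addrC le_ln1Dx//; lra.
rewrite -ler_ln ?posrE ?powR_gt0// ln_powR.
(* Concavity of [ln] at the weighted mean [a = p * u + (1 - p)]: the bounds [ln x <= x - 1] at
   [u / a] and at [1 / a], with weights [p] and [1 - p], have right sides adding up to 0. *)
have := ler_wpM2l p0 (ln_le (u / a) (divr_gt0 u0 a0)).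
have p1' : 0 <= 1 - p by lra.
have ia0 : 0 < a^-1 by rewrite invr_gt0.
have := ler_wpM2l p1' (ln_le a^-1 ia0).
rewrite lnM ?posrE ?invr_gt0// lnV ?posrE//.
have : p * (u / a - 1) + (1 - p) * (a^-1 - 1) = 0.
  by rewrite /a; field; rewrite -/a gt_eqF.
move: (u / a) (a^-1) => x y; lra.
Qed.

(** The tangent bound at [(n + 2) / (n + 1)]. It yields the submartingale inequality, the lower
    bound of [growth] and the monotonicity of [growth_ratio]. *)
Lemma powR_succ_le p n : 0 <= p <= 1 ->
  n.+2%:R `^ p <= (1 + p / n.+1%:R) * n.+1%:R `^ p.
Proof.
move=> p01.
have -> : n.+2%:R = n.+1%:R * (n.+2%:R / n.+1%:R) :> R by rewrite mulrC divfK.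
rewrite powRM// mulrC ler_wpM2r ?powR_ge0//.
apply: le_trans (powR_le_tangent p01 _) _ => //.
suff -> : n.+2%:R / n.+1%:R - 1 = n.+1%:R^-1 :> R by [].
by rewrite -(natr1 n.+1) mulrDl divff// mul1r addrAC subrr add0r.
Qed.

(** This is [Gamma(n + 1 + p) / (Gamma(1 + p) * n!)], the growth that the mean of [L_n] would have
    if the ceiling did not round. *)
Definition growth p n : R := \prod_(k < n) (1 + p / k.+1%:R).

Lemma growthS p n : growth p n.+1 = growth p n * (1 + p / n.+1%:R).
Proof. by rewrite /growth big_ord_recr. Qed.

Lemma growth_ge1 p n : 0 <= p -> 1 <= growth p n.
Proof.
move=> p0; elim: n => [|n IH]; first by rewrite /growth big_ord0.
rewrite growthS; apply: mulr_ege1 => //.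
by rewrite lerDl divr_ge0.
Qed.

Lemma growth_gt0 p n : 0 <= p -> 0 < growth p n.
Proof. by move=> /growth_ge1 h; rewrite (lt_le_trans ltr01). Qed.

Lemma growth_homo p : 0 <= p -> {homo growth p : m n / (m <= n)%N >-> m <= n}.
Proof.
move=> p0; apply/nondecreasing_seqP => n.
by rewrite growthS ler_peMr ?(ltW (growth_gt0 _ p0))// lerDl divr_ge0.
Qed.

(* Makes the one-step errors of [L_n / b_n] after time [m] sum to [O(1 / b_m)]. *)
Lemma growth_telescope p n : 0 < p ->
  (n.+1%:R * growth p n.+1)^-1 = p^-1 * ((growth p n)^-1 - (growth p n.+1)^-1).
Proof.
move=> p0; have g0 := growth_gt0 n (ltW p0).
rewrite growthS; field.
have n0 : 0 < 1 + n%:R :> R by rewrite ltr_pwDl.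
by rewrite !gt_eqF//= -?natr1; lra.
Qed.

Lemma powR_le_growth p n : 0 <= p <= 1 -> n.+1%:R `^ p <= growth p n.
Proof.
move=> p01; have /andP[p0 p1] := p01.
elim: n => [|n IH]; first by rewrite powR1 /growth big_ord0.
apply: le_trans (powR_succ_le _ p01) _; rewrite growthS mulrC.
by rewrite ler_wpM2r// addr_ge0// divr_ge0.
Qed.

(** The tangent bound again, now at [(n + 1) / (n + 2)]: with [t = p / (n + 2)] each induction step
    costs a factor at most [(1 - t) * (1 + t) <= 1]. *)
Lemma growth_le_powR p n : 0 <= p <= 1 ->
  growth p n.+1 <= (1 + p) * n.+1%:R `^ p.
Proof.
move=> p01; have /andP[p0 p1] := p01.
elim: n => [|n IH].
  by rewrite powR1 growthS /growth big_ord0 mul1r mulr1 divr1.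
rewrite growthS.
set x : R := n.+2%:R; set y : R := n.+1%:R.
have x0 : 0 < x by []. have y0 : 0 < y by [].
have xy : x = y + 1 by rewrite /x /y natr1.
have h : (y / x) `^ p * (1 + p / x) <= 1.
  have /= := powR_le_tangent p01 (divr_gt0 y0 x0).
  have -> : 1 + p * (y / x - 1) = 1 - p / x.
    by rewrite (_ : y = x - 1) ?xy ?addrK// -xy; field; rewrite gt_eqF.
  have t0 : 0 <= p / x by rewrite divr_ge0// ltW.
  move: (p / x) t0 => t t0 h.
  have := ler_wpM2r (_ : 0 <= 1 + t) h; rewrite addr_ge0// => /(_ isT).
  move=> /le_trans; apply; nra.
have := IH; rewrite -/y => /(ler_wpM2r (_ : 0 <= 1 + p / x)).
rewrite addr_ge0 ?divr_ge0 ?(ltW x0)// => /(_ isT) /le_trans; apply.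
rewrite -[X in _ * X `^ _ * _ <= _](divfK (lt0r_neq0 x0)) powRM; last 2 first.
- by rewrite divr_ge0 ?(ltW x0) ?(ltW y0).
- exact: ltW.
have c0 : 0 <= (1 + p) * x `^ p by rewrite mulr_ge0 ?powR_ge0// addr_ge0.
rewrite (_ : _ * (1 + p / x) =
  (1 + p) * x `^ p * ((y / x) `^ p * (1 + p / x))); last by ring.
by rewrite ler_piMr.
Qed.

Definition growth_ratio p n := growth p n / n.+1%:R `^ p.

Lemma growth_ratio_gt0 p n : 0 <= p -> 0 < growth_ratio p n.
Proof. by move=> p0; rewrite divr_gt0 ?powR_gt0 ?growth_gt0. Qed.

Lemma growth_ratio_le p n : 0 <= p <= 1 -> growth_ratio p n <= 1 + p.
Proof.
move=> p01; have /andP[p0 p1] := p01.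
rewrite /growth_ratio; case: n => [|n].
  by rewrite /growth big_ord0 powR1 divr1 lerDl.
rewrite ler_pdivrMr ?powR_gt0//; apply: le_trans (growth_le_powR _ p01) _.
by rewrite ler_wpM2l ?addr_ge0// ge0_ler_powR ?nnegrE// ler_nat.
Qed.

(** Nondecreasing and bounded by [1 + p]. The limit, [1 / Gamma(1 + p)], is the exchange rate
    between the normalizations [b_n] and [(n + 1)^p]. *)
Lemma growth_ratio_cvg p : 0 <= p <= 1 ->
  exists2 g : R, 0 < g & growth_ratio p n @[n --> \oo] --> g.
Proof.
move=> p01; have /andP[p0 p1] := p01.
have nd : {homo growth_ratio p : m n / (m <= n)%N >-> m <= n}.
  apply/nondecreasing_seqP => n; rewrite /growth_ratio growthS.
  rewrite ler_pdivrMr ?powR_gt0// mulrAC ler_pdivlMr ?powR_gt0//.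
  rewrite -!mulrA ler_wpM2l ?(ltW (growth_gt0 n p0))//.
  exact: powR_succ_le.
have cv : cvgn (growth_ratio p).
  by apply: nondecreasing_is_cvgn => //; exists (1 + p) => _ [n _ <-];
    exact: growth_ratio_le.
exists (limn (growth_ratio p)) => //.
apply: lt_le_trans (nondecreasing_cvgn_le nd cv 0).
exact: growth_ratio_gt0.
Qed.

(** An exponent [m] with [m * p >= 4] suffices. The power 4 bounds the second moment of a gap by a
    multiple of [(k + 2)^-4], hence its mean by a multiple of the summable [(k + 2)^-2]. *)
Lemma growth_polynomial p : 0 < p -> p <= 1 ->
  exists2 m, (0 < m)%N & forall k, k.+2%:R ^+ 4 <= growth p (k.+2 ^ m).-1.
Proof.
move=> p0 p1; have p01 : 0 <= p <= 1 by rewrite (ltW p0).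
exists (Num.truncn (4 / p)).+1 => // k.
set m := (Num.truncn _).+1.
apply: le_trans (powR_le_growth _ p01).
rewrite prednK ?expn_gt0// natrX -powR_mulrn// -powRrM -[leLHS]powR_mulrn//.
apply: ler_powR; first by rewrite ler1n.
by rewrite -ler_pdivrMr// ltW// truncnS_gt.
Qed.

(** For a ratio [r >= 1] and [p <= 1] one has [1 <= r^p <= r], which squeezes. *)
Lemma powR_ratio_cvg1 p (a b : nat -> R) : 0 <= p <= 1 ->
  (forall n, 0 < b n <= a n) -> a n / b n @[n --> \oo] --> (1 : R) ->
  a n `^ p / b n `^ p @[n --> \oo] --> (1 : R).
Proof.
move=> /andP[p0 p1] ba cv.
have e n : a n `^ p / b n `^ p = (a n / b n) `^ p.
  have /andP[b0 ab] := ba n.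
  apply/(canLR (mulfK _)); first by rewrite gt_eqF ?powR_gt0.
  by rewrite -powRM ?divfK ?gt_eqF ?divr_ge0 ?(ltW b0)// (le_trans (ltW b0)).
under eq_fun do rewrite e.
apply: (squeeze_cvgr _ (cvg_cst (1 : R)) cv); apply: nearW => n.
have /andP[b0 ab] := ba n.
have h : 1 <= a n / b n by rewrite ler_pdivlMr// mul1r.
rewrite ler1_powR// andbT.
have := @ge0_ler_powR _ _ p0 1 (a n / b n); rewrite powR1 !nnegrE => -> //.
exact: le_trans h.
Qed.

End Growth.

(** * From a subsequence to the full sequence *)

Section Subsequence.
Context {R : realType}.
Implicit Types (n m k : nat).

(** For [s k <= n < s (k + 1)] monotonicity puts [a n / b n] between [a (s k) / b (s (k + 1))] and
    [a (s (k + 1)) / b (s k)]; both tend to [l] because the ratio of consecutive [b (s k)] tends to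
    1. *)
Lemma monotone_ratio_cvg (a b : nat -> R) (s : nat -> nat) (l : R) :
  (forall n, 0 <= a n) -> {homo a : m n / (m <= n)%N >-> m <= n} ->
  (forall n, 0 < b n) -> {homo b : m n / (m <= n)%N >-> m <= n} ->
  {homo s : m n / (m < n)%N} ->
  a (s k) / b (s k) @[k --> \oo] --> l ->
  b (s k.+1) / b (s k) @[k --> \oo] --> (1 : R) ->
  a n / b n @[n --> \oo] --> l.
Proof.
move=> a0 ndA b0 ndB sinc cvl cv1.
have s_ge k : (k <= s k)%N.
  by elim: k => // k IH; apply: leq_ltn_trans IH (sinc _ _ (ltnSn k)).
have sle m n : (m <= n)%N -> (s m <= s n)%N.
  by rewrite leq_eqVlt => /predU1P[->//|/sinc/ltnW].
have bneq n : b n != 0 by rewrite gt_eqF.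
have cvu : a (s k) / b (s k.+1) @[k --> \oo] --> l.
  rewrite -[l]divr1 (_ : (fun k => _) =
    (fun k => a (s k) / b (s k) / (b (s k.+1) / b (s k)))).
    by apply: cvgM => //; apply: cvgV => //; exact: oner_neq0.
  by apply/funext => k; field; rewrite !bneq.
have cvv : a (s k.+1) / b (s k) @[k --> \oo] --> l.
  rewrite -[l]mulr1 (_ : (fun k => _) =
    (fun k => a (s k.+1) / b (s k.+1) * (b (s k.+1) / b (s k)))).
    by apply: cvgM => //; rewrite (cvg_shiftS (fun k => a (s k) / b (s k))).
  by apply/funext => k; field; rewrite !bneq.
apply/cvgrPdist_lt => e e0.
have /cvgrPdist_lt/(_ _ e0)[K1 _ hu] := cvu.
have /cvgrPdist_lt/(_ _ e0)[K2 _ hv] := cvv.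
exists (s (maxn K1 K2)) => // n /= Kn.
have exk : exists k, (n < s k.+1)%N by exists n; exact: s_ge.
case: (ex_minnP exk) => k nk kmin.
have Kk : (maxn K1 K2 <= k)%N.
  rewrite leqNgt; apply/negP => kK.
  by have := leq_trans nk (leq_trans (sle _ _ kK) Kn); rewrite ltnn.
have kn : (s k <= n)%N.
  case: k kmin Kk {nk} => [_ K0|k kmin _].
    by apply: leq_trans Kn; exact: sle.
  by rewrite leqNgt; apply/negP => /kmin; rewrite ltnn.
have /hu := leq_trans (leq_maxl _ _) Kk; rewrite ltr_distlC => /andP[u1 u2].
have /hv := leq_trans (leq_maxr _ _) Kk; rewrite ltr_distlC => /andP[v1 v2].
rewrite ltr_distlC; apply/andP; split.
  apply: lt_le_trans u1 _; apply: ler_pM => //; rewrite ?invr_ge0 ?(ltW (b0 _))//.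
    exact: ndA.
  by rewrite lef_pV2 ?posrE// ndB// ltnW.
apply: le_lt_trans v2; apply: ler_pM => //; rewrite ?invr_ge0 ?(ltW (b0 _))//.
  by apply: ndA; rewrite ltnW.
by rewrite lef_pV2 ?posrE// ndB.
Qed.

End Subsequence.

(** * Relative ranks *)

Section Ranks.
Context {R : realType}.
Implicit Types (x y : nat -> R) (n m i j k : nat).

(** If [x j < x i], then [i] itself is counted in the rank of [i] but not in that of [j]; ties do no
    harm. *)
Lemma leq_rank x n i j : (i < n)%N -> (rank x n i <= rank x n j)%N = (x i <= x j).
Proof.
move=> ni; apply/idP/idP => [|xij]; last first.
  apply: leq_sum => k _; case: (leP (x k) (x i)) => //= xki.
  by rewrite (le_trans xki xij).
apply: contraTT; rewrite -ltNge -ltnNge => xji.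
rewrite /rank (bigD1 (Ordinal ni))//= [ltnRHS](bigD1 (Ordinal ni))//=.
rewrite lexx leNgt xji add0n add1n ltnS; apply: leq_sum => k _.
by case: (leP (x k) (x j)) => //= xkj; rewrite (le_trans xkj (ltW xji)).
Qed.

Lemma rank_gt0 x n i : (i < n)%N -> (0 < rank x n i)%N.
Proof.
by move=> ni; rewrite /rank (bigD1 (Ordinal ni))//= lexx.
Qed.

Lemma rank_leq x n i : (rank x n i <= n)%N.
Proof.
rewrite -[leqRHS]card_ord -sum1_card; apply: leq_sum => j _.
by case: (_ <= _).
Qed.

(** The equivalence relation whose classes, pulled back to outcomes, are the atoms of the rank
    field. *)
Definition same_ranks n x y := forall i, (i < n)%N -> rank x n i = rank y n i.

Lemma same_ranks_sym n x y : same_ranks n x y -> same_ranks n y x.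
Proof. by move=> xy i ni; rewrite xy. Qed.

Lemma same_ranksP n x y : same_ranks n x y <->
  forall i j, (i < n)%N -> (j < n)%N -> (x i <= x j) = (y i <= y j).
Proof.
split=> [xy i j ni nj|xy i ni]; first by rewrite -!(@leq_rank _ n)// !xy.
by apply: eq_bigr => j _; rewrite xy.
Qed.

Lemma same_ranks_leq m n x y : (m <= n)%N -> same_ranks n x y -> same_ranks m x y.
Proof.
move=> mn /same_ranksP xy; apply/same_ranksP => i j mi mj.
by apply: xy; exact: leq_trans mn.
Qed.

Lemma same_ranks_retained p n x y : same_ranks n x y ->
  retained p x n = retained p y n.
Proof.
elim: n => // n IH xy /=.
by rewrite IH ?xy//; exact: same_ranks_leq xy.
Qed.

Lemma retained_leq p x n : (retained p x n <= n)%N.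
Proof. by elim: n => //= n IH; rewrite -addn1 leq_add ?leq_b1. Qed.

Lemma retained_homo p x : {homo retained p x : m n / (m <= n)%N}.
Proof. by apply: homo_leq => //=; [exact: leq_trans|move=> n; exact: leq_addr]. Qed.

Definition injective_upto n x :=
  forall i j, (i < n)%N -> (j < n)%N -> x i = x j -> i = j.

Lemma same_ranks_injective_upto n x y : same_ranks n x y ->
  injective_upto n x -> injective_upto n y.
Proof.
move=> /same_ranksP xy xinj i j ni nj yij; apply: xinj => //.
by apply/eqP; rewrite eq_le !xy// yij lexx.
Qed.

Lemma rank_inj n x i j : injective_upto n x -> (i < n)%N -> (j < n)%N ->
  rank x n i = rank x n j -> i = j.
Proof.
move=> xinj ni nj rij; apply: xinj => //.
by apply/eqP; rewrite eq_le -!(@leq_rank _ n)// rij leqnn.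
Qed.

(** Pigeonhole: without ties the ranks, lowered by one, form an injection of ['I_n] into itself. *)
Lemma rank_onto n x k : injective_upto n x -> (0 < k <= n)%N ->
  exists2 i, (i < n)%N & rank x n i = k.
Proof.
case: n => [|n] xinj /andP[k0 kn]; first by case: k k0 kn.
pose f (i : 'I_n.+1) : 'I_n.+1 := inord (rank x n.+1 i).-1.
have fE (i : 'I_n.+1) : (f i).+1 = rank x n.+1 i.
  have := rank_leq x n.+1 i; have := rank_gt0 x (ltn_ord i).
  by rewrite /f; case: (rank x n.+1 i) => // r _ rn; rewrite inordK.
have finj : injective f.
  move=> i j /(congr1 (fun u : 'I__ => u.+1)); rewrite !fE => /rank_inj ij.
  exact/val_inj/ij.
have [g _ fg] := injF_bij finj.
exists (g (inord k.-1)) => //; rewrite -fE fg inordK prednK//.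
Qed.

Definition swap (T : Type) (a b : nat) (x : nat -> T) : nat -> T :=
  fun k => x (if k == a then b else if k == b then a else k).

Lemma swapE (T : Type) a b (x : nat -> T) k :
  swap a b x k = x (if k == a then b else if k == b then a else k).
Proof. by []. Qed.

(** A value [x k] in [(x a, x b]] with [k] distinct from [b] would make both [k] and [b] count for
    [b] but not for [a], a difference of ranks of at least 2. *)
Lemma rank_adjacent_le n x a b k : (a < n)%N -> (b < n)%N -> (k < n)%N ->
  rank x n b = (rank x n a).+1 -> k <> b -> (x k <= x b) = (x k <= x a).
Proof.
move=> na nb nk ab kb.
have xab : x a < x b by rewrite ltNge -(@leq_rank _ n)// ab ltnn.
apply/idP/idP => [xkb|/le_trans]; last by apply; exact: ltW.
rewrite leNgt; apply/negP => xak.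
suff : ((rank x n a).+1 < rank x n b)%N by rewrite ab ltnn.
have bk : Ordinal nb != Ordinal nk by apply/eqP => -[]/esym.
rewrite /rank (bigD1 (Ordinal nk))//= (bigD1 (Ordinal nb))//=.
rewrite [ltnRHS](bigD1 (Ordinal nk))//= [X in (_ < _ + X)%N](bigD1 (Ordinal nb))//=.
rewrite xkb lexx !leNgt xak xab/= !add0n !add1n !ltnS.
apply: leq_sum => j _; case: (leP (x j) (x a)) => //= xja.
by rewrite (le_trans xja (ltW xab)).
Qed.

Lemma rank_adjacent_ge n x a b k : injective_upto n x ->
  (a < n)%N -> (b < n)%N -> (k < n)%N ->
  rank x n b = (rank x n a).+1 -> k <> a -> (x b <= x k) = (x a <= x k).
Proof.
move=> xinj na nb nk ab ka.
have xab : x a < x b by rewrite ltNge -(@leq_rank _ n)// ab ltnn.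
apply/idP/idP => [/(le_trans (ltW xab))//|xak].
have [->//|kb] := eqVneq k b.
rewrite leNgt; apply/negP => xkb.
have := rank_adjacent_le na nb nk ab (elimN eqP kb).
rewrite (ltW xkb) => /esym xka.
by apply: ka; apply: xinj => //; apply/eqP; rewrite eq_le xka.
Qed.

Lemma rank_swap n x a b k : (a < n)%N -> (b < n)%N ->
  rank (swap a b x) n k = rank x n (if k == a then b else if k == b then a else k).
Proof.
move=> na nb; rewrite /rank.
rewrite [RHS](reindex_inj (@perm_inj _ (tperm (Ordinal na) (Ordinal nb))))/=.
apply: eq_bigr => j _; rewrite !swapE; congr (nat_of_bool (x _ <= _)).
case: tpermP => [->|->|ja jb] /=; first by rewrite eqxx.
  by rewrite eqxx; case: eqP => // ->.
case: eqP => [ja'|_]; first by case: ja; exact: val_inj.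
by case: eqP => [jb'|_] //; case: jb; exact: val_inj.
Qed.

Lemma injective_upto_swap n x a b : (a < n)%N -> (b < n)%N ->
  injective_upto n x -> injective_upto n (swap a b x).
Proof.
move=> na nb xinj i j ni nj; rewrite !swapE => /xinj.
have lt k : (k < n)%N -> ((if k == a then b else if k == b then a else k) < n)%N.
  by move=> nk; case: ifP => // _; case: ifP.
move=> /(_ (lt _ ni) (lt _ nj)).
do ![case: eqP => //] => *; congruence.
Qed.

(* Exchanging two values of consecutive ranks does not change how either
   compares with any other value. *)
Lemma same_ranks_swap n x i : injective_upto n.+1 x -> (i < n)%N ->
  rank x n.+1 i = (rank x n.+1 n).+1 \/ rank x n.+1 n = (rank x n.+1 i).+1 ->
  same_ranks n x (swap i n x).
Proof.
move=> xinj ni adj; have ni1 : (i < n.+1)%N by exact: leqW.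
have nn : (n < n.+1)%N by [].
have le_ l : (l < n)%N -> l <> i -> (x l <= x i) = (x l <= x n).
  move=> ln li; have ln1 : (l < n.+1)%N by exact: leqW.
  case: adj => adj; first exact: rank_adjacent_le adj _.
  by apply/esym; apply: rank_adjacent_le adj _ => // ln'; rewrite ln' ltnn in ln.
have ge_ l : (l < n)%N -> l <> i -> (x i <= x l) = (x n <= x l).
  move=> ln li; have ln1 : (l < n.+1)%N by exact: leqW.
  case: adj => adj; last by apply/esym; exact: rank_adjacent_ge adj _.
  by apply: rank_adjacent_ge adj _ => // ln'; rewrite ln' ltnn in ln.
apply/same_ranksP => l k ln kn; rewrite !swapE.
rewrite (ltn_eqF ln) (ltn_eqF kn).
case: eqP => [->|li]; case: eqP => [->|ki]; rewrite ?lexx//.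
- exact: ge_.
- exact: le_.
Qed.

End Ranks.

(** * Events determined by the ranks *)

Section RankMeasurability.

(** Finitely many value vectors occur, so [A] is a finite union of their level sets. The measurable
    structure is left general: the lemma serves the ambient sigma-field and the one generated by the
    ranks. *)
Lemma saturated_measurable d (T : measurableType d) n N (r : nat -> T -> nat)
    (A : set T) :
  (forall i k, (i < n)%N -> measurable [set w | r i w = k]) ->
  (forall i w, (r i w <= N)%N) ->
  (forall w w', (forall i, (i < n)%N -> r i w = r i w') -> A w -> A w') ->
  measurable A.
Proof.
move=> mr rN satA.
have -> : A = \bigcup_(v in [set v : {ffun 'I_n -> 'I_N.+1} |
      exists2 w, A w & forall i : 'I_n, r i w = v i])
    \bigcap_(i in [set: 'I_n]) [set w | r i w = v i].
  apply/seteqP; split=> [w Aw|w [v [w' Aw' w'v] wv]].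
    have vE (i : 'I_n) : r i w = [ffun i : 'I_n => inord (r i w) : 'I_N.+1] i.
      by rewrite ffunE inordK// ltnS.
    by exists [ffun i : 'I_n => inord (r i w)]; [exists w|move=> i _; exact: vE].
  by apply: satA Aw' => i ni; rewrite (w'v (Ordinal ni)) (wv (Ordinal ni)).
apply: fin_bigcup_measurable => [|v _]; first exact: finite_finset.
by apply: fin_bigcap_measurable => [|i _]; [exact: finite_finset|exact: mr].
Qed.

Lemma measurable_rank d (T : measurableType d) (R : realType)
    (Y : nat -> T -> R) (mY : forall i, measurable_fun [set: T] (Y i)) n i k :
  measurable [set w | rank (fun j => Y j w) n i = k].
Proof.
have m_le j : measurable_fun [set: T] (fun w => (Y j w <= Y i w)%R%:R : R).
  rewrite (_ : (fun w => _) = fun w => if Y j w <= Y i w then 1 else 0); last first.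
    by apply/funext => w; case: ifP.
  apply: measurable_fun_ifT => //.
  exact: measurable_fun_ler.
have : measurable_fun [set: T] (fun w => \sum_(j < n) (Y j w <= Y i w)%R%:R : R).
  exact: measurable_sum.
move=> /(_ measurableT _ (measurable_set1 k%:R)); rewrite setTI.
congr (measurable _); apply/seteqP; split => w /=; rewrite -natr_sum.
  by move=> /eqP; rewrite eqr_nat => /eqP.
by rewrite /rank => ->.
Qed.

Lemma measurable_same_ranks d (T : measurableType d) (R : realType)
    (Y : nat -> T -> R) (mY : forall i, measurable_fun [set: T] (Y i)) n
    (A : set T) :
  (forall w w', same_ranks n (fun j => Y j w) (fun j => Y j w') -> A w -> A w') ->
  measurable A.
Proof.
apply: (@saturated_measurable _ _ n n (fun i w => rank (fun j => Y j w) n i)).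
- by move=> i k _; exact: measurable_rank.
- by move=> i w; exact: rank_leq.
Qed.

(** Saturated sets form a sigma-algebra containing the generators, which gives one direction; the
    other is the finite union of rank patterns, formed inside the generated sigma-field. *)
Lemma rank_fieldP d (T : measurableType d) (R : realType) (P : probability T R)
    (X : nat -> {RV P >-> R}) n (A : set T) :
  rank_field X n A <->
  (forall w w', same_ranks n (fun j => X j w) (fun j => X j w') -> A w -> A w').
Proof.
pose G := \big[setU/set0]_(i < n) preimage_set_system [set: T]
    (fun w => rank (fun k => X k w) n i) (@measurable _ nat).
split=> [FA|satA]; last first.
  suff : @measurable _ (g_sigma_algebraType G) A by [].
  apply: (@saturated_measurable _ (g_sigma_algebraType G) n n
    (fun i w => rank (fun j => X j w) n i)) => //.
  - move=> i k ni; apply: sub_sigma_algebra.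
    rewrite /G (bigD1 (Ordinal ni))//=; left; exists [set k] => //.
    by rewrite setTI.
  - by move=> i w; exact: rank_leq.
have : (<<s G >> `<=` [set B : set T | forall w w',
    same_ranks n (fun j => X j w) (fun j => X j w') -> B w -> B w']); last exact.
apply: smallest_sub; first split.
- by move=> w w' _.
- by move=> B satB w w' ww' [_ nBw]; split => // /(satB _ _ (same_ranks_sym ww')).
- by move=> F satF w w' ww' [k _ Fkw]; exists k => //; exact: satF Fkw.
rewrite /G; apply: (big_ind (fun B => B `<=` _)) => //.
- by move=> B C hB hC D [/hB|/hC].
- move=> i _ _ [V _ <-] w w' ww' [_ Vw]; split=> //=.
  by move: Vw; rewrite /= ww'.
Qed.

End RankMeasurability.

(** * Exchangeability *)

Section SequenceSpace.
Context {R : realType}.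

(* Rectangles carry a full sequence of sides, all but finitely many trivial,
   which makes stability under intersection immediate. *)
Definition rectangles : set_system (nat -> R) :=
  [set S | exists n (B : nat -> set R), [/\ forall i, measurable (B i),
    forall i, (n <= i)%N -> B i = [set: R] & S = [set x | forall i, B i (x i)]]].

Definition sequences := g_sigma_algebraType rectangles.

Lemma rectangles_setI : setI_closed rectangles.
Proof.
move=> _ _ [n [B [mB BT ->]]] [m [C [mC CT ->]]].
exists (maxn n m), (fun i => B i `&` C i); split.
- by move=> i; exact: measurableI.
- by move=> i; rewrite geq_max => /andP[ni mi]; rewrite BT// CT// setIT.
- apply/seteqP; split=> x /=; first by move=> [Bx Cx] i; split.
  by move=> BCx; split=> i; case: (BCx i).
Qed.

Lemma rectangles_setT : rectangles [set: nat -> R].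
Proof. by exists 0%N, (fun=> [set: R]); split => //; apply/seteqP; split. Qed.

Lemma measurable_coordinate i :
  measurable_fun [set: sequences] ((fun x => x i) : sequences -> R).
Proof.
move=> _ B mB; rewrite setTI; apply: sub_sigma_algebra.
exists i.+1, (fun j => if j == i then B else [set: R]); split.
- by move=> j; case: ifP.
- by move=> j ij; rewrite gtn_eqF.
- apply/seteqP; split=> x /= => [Bx j|/(_ i)]; last by rewrite eqxx.
  by case: eqP => // ->.
Qed.

Lemma measurable_sequences d (T : measurableType d) (Y : nat -> T -> R) :
  (forall i, measurable_fun [set: T] (Y i)) ->
  measurable_fun [set: T] ((fun w i => Y i w) : T -> sequences).
Proof.
move=> mY; apply: (@measurability _ _ T sequences _ _ rectangles) => // _ [_ [n [B [mB BT ->]]] <-].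
rewrite setTI (_ : _ @^-1` _ = \bigcap_(i < n) (Y i @^-1` B i)).
  apply: fin_bigcap_measurable => // i _.
  by rewrite -[X in measurable X]setTI; exact: mY.
apply/seteqP; split=> w /= => [Bw i _|Bw i]; first exact: Bw.
by have [ni|ni] := ltnP i n; [exact: Bw|rewrite BT].
Qed.

End SequenceSpace.

Section Exchangeability.
Context d (T : measurableType d) (R : realType) (P : probability T R).
Local Open Scope ereal_scope.
Variable X : nat -> {RV P >-> R}.
Hypothesis indepX : mutually_independent X.

Lemma mutually_independent_iota (B : nat -> set R) n :
  (forall i, measurable (B i)) ->
  P [set w | forall i, (i < n)%N -> B i (X i w)] =
  \prod_(i <- iota 0 n) P (X i @^-1` B i).
Proof.
move=> mB; have := @indepX [fset i in iota 0 n]%fset _ mB.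
rewrite (perm_big (iota 0 n)); last first.
  apply: uniq_perm; rewrite ?iota_uniq ?fset_uniq// => i.
  by rewrite !inE.
move=> <-; congr (P _); apply/seteqP; split=> w /= Bw i.
  by rewrite /= !inE mem_iota add0n/= => ni; exact: Bw.
by move=> ni; apply: Bw; rewrite /= !inE mem_iota.
Qed.

Hypothesis idX : identically_distributed X.

(** Both laws on sequence space agree on the rectangles, which are stable under intersection: there
    independence gives a product over coordinates, and equal marginals allow its factors to be
    permuted. *)
Lemma exchangeable_swap a b (S : set sequences) : measurable S ->
  P [set w | S (swap a b (fun i => X i w))] = P [set w | S (fun i => X i w)].
Proof.
move=> mS.
pose s k := if k == a then b else if k == b then a else k.
have sK : involutive s.
  by move=> k; rewrite /s; do ![case: eqP => //] => *; congruence.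
have mX i : measurable_fun [set: T] (X i) by exact: measurable_funPT.
have mY : measurable_fun [set: T] ((fun w i => X i w) : T -> sequences).
  by apply: (measurable_sequences (Y := fun i => X i)).
have mZ : measurable_fun [set: T] ((fun w i => X (s i) w) : T -> sequences).
  by apply: (measurable_sequences (Y := fun i => X (s i))).
pose Y : {mfun T >-> sequences} := mfun_Sub (mem_set mY).
pose Z : {mfun T >-> sequences} := mfun_Sub (mem_set mZ).
suff : distribution P Z S = distribution P Y S by [].
have := @measure_unique _ R sequences rectangles (fun=> [set: nat -> R]) erefl
  rectangles_setI (fun=> rectangles_setT).
have cover : \bigcup_(k : nat) [set: nat -> R] = [set: nat -> R].
  by apply/seteqP; split => // x _; exists 0%N.
move=> /(_ cover (distribution P Z) (distribution P Y)); apply => //.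
- move=> _ [n [B [mB BT ->]]].
  rewrite /distribution /pushforward/=.
  (* Large enough that the transposition [s] maps the first [N] indices onto themselves. *)
  pose N := maxn n (maxn a.+1 b.+1).
  have sN k : (k < N)%N -> (s k < N)%N.
    by rewrite /s /N !leq_max => kN; do ![case: eqP => _]; rewrite ?ltnSn ?orbT.
  have BTN k : (N <= k)%N -> B k = setT by rewrite geq_max => /andP[/BT].
  transitivity (P [set w | forall i, (i < N)%N -> B (s i) (X i w)]).
    congr (P _); apply/seteqP; split=> w /= Bw i.
      by move=> _; have := Bw (s i); rewrite sK.
    have [iN|Ni] := ltnP i N; last by rewrite BTN.
    by have := Bw (s i) (sN _ iN); rewrite sK.
  transitivity (P [set w | forall i, (i < N)%N -> B i (X i w)]); last first.
    congr (P _); apply/seteqP; split=> w /= Bw i; last by move=> _; exact: Bw.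
    by have [iN|Ni] := ltnP i N; [exact: Bw|rewrite BTN].
  have e C : (forall i, measurable (C i)) ->
      P [set w | forall i, (i < N)%N -> C i (X i w)] =
      \prod_(i <- iota 0 N) distribution P (X 0%N) (C i).
    move=> mC; rewrite mutually_independent_iota//.
    by apply: eq_bigr => i _; exact: idX.
  transitivity (\prod_(i <- iota 0 N) distribution P (X 0%N) (B i)); last first.
    exact: esym (e B mB).
  apply: (etrans (e (B \o s) _)) => //=.
  rewrite -(big_map s xpredT (fun i => distribution P (X 0%N) (B i))).
  apply: perm_big; apply: uniq_perm; rewrite ?iota_uniq//.
    by rewrite map_inj_uniq ?iota_uniq//; exact: inv_inj.
  move=> k; apply/mapP/idP => [[l]|].
    by rewrite !mem_iota !add0n/= => lN ->; exact: sN.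
  by rewrite mem_iota add0n/= => kN; exists (s k); rewrite ?sK// mem_iota add0n/= sN.
- by move=> _; rewrite (le_lt_trans (probability_le1 _ _)) ?ltry.
Qed.

End Exchangeability.

(** * Ties have probability zero *)

Section NoTies.
Context d (T : measurableType d) (R : realType) (P : probability T R).
Local Open Scope ereal_scope.
Variable X : nat -> {RV P >-> R}.
Hypothesis indepX : mutually_independent X.
Hypothesis contX : forall i, continuous (cdf (X i)).

(** The atom at [x] is at most [F(x) - F(y)] for every [y < x]; continuity of the distribution
    function lets [y] tend to [x]. *)
Lemma distribution_set1 i (x : R) : distribution P (X i) [set x] = 0.
Proof.
pose mu := distribution P (X i).
apply/eqP; rewrite eq_le measure_ge0 andbT.
have fin y : cdf (X i) y \is a fin_num by exact: fin_num_measure.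
have le_ y : (y < x)%R -> mu [set x] <= cdf (X i) x - cdf (X i) y.
  move=> yx; rewrite leeBrDr// /cdf -measureU//.
  - apply: le_measure; rewrite ?inE//; first exact: measurableU.
    by move=> z [->|] /=; rewrite in_itv/= ?lexx// => /le_trans; apply; exact: ltW.
  - apply/seteqP; split=> // z [/= ->]; rewrite in_itv/= => xy.
    by rewrite ltNge xy in yx.
have cv : cdf (X i) x - cdf (X i) y @[y --> x^'-] --> cdf (X i) x - cdf (X i) x.
  apply: cvgeB.
  - by rewrite fin_num_adde_defl// fin_numN.
  - exact: cvg_cst.
  - by apply: cvg_at_left_filter; exact: contX.
rewrite subee// in cv.
apply: (cvge_ge _ cv) => //.
near=> y; apply: le_; near: y; exact: nbhs_left_lt.
Unshelve. all: by end_near. Qed.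

(** By independence the law of the pair is the product of its marginals, and each section of the
    diagonal is a single point. *)
Lemma ties_null i j : i != j -> P [set w | X i w = X j w] = 0.
Proof.
move=> ij.
have mXY : measurable_fun [set: T] (fun w => (X i w, X j w)).
  by apply: measurable_fun_pair; exact: measurable_funPT.
pose XY : {mfun T >-> (R * R)%type} := mfun_Sub (mem_set mXY).
pose mu k := distribution P (X k).
have prodE A B : measurable A -> measurable B ->
    distribution P XY (A `*` B) = mu i A * mu j B.
  move=> mA mB.
  pose C k := if k == i then A else if k == j then B else [set: R].
  have mC k : measurable (C k) by rewrite /C; do ![case: ifP => //].
  have := @indepX [fset i; j]%fset _ mC.
  rewrite big_fsetU1 ?inE//= big_seq_fset1 /C eqxx eq_sym (negbTE ij) eqxx => <-.
  congr (P _); apply/seteqP; split=> w /=.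
    move=> [/= Aw Bw] k; rewrite /= !inE => /orP[/eqP ->|/eqP ->].
      by rewrite eqxx.
    by rewrite eq_sym (negbTE ij) eqxx.
  move=> Cw; split.
    by have := Cw i; rewrite /= !inE !eqxx; apply.
  by have := Cw j; rewrite /= !inE !eqxx orbT eq_sym (negbTE ij); apply.
pose D : set (R * R) := [set z | z.1 = z.2].
have mD : measurable D.
  rewrite (_ : D = (fun z => z.1 - z.2)%R @^-1` [set 0%R]); last first.
    apply/seteqP; split=> z /=; rewrite /D/=; first by move=> ->; rewrite subrr.
    by move=> /eqP; rewrite subr_eq0 => /eqP.
  rewrite -[X in measurable X]setTI.
  have mB := measurable_funB
    (@measurable_fst _ _ R R) (@measurable_snd _ _ R R).
  exact: (mB measurableT).
transitivity (distribution P XY D) => //.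
rewrite -(product_measure_unique prodE mD).
rewrite /product_measure1; apply: integral0_eq => x _ /=.
rewrite (_ : xsection D x = [set x]); first exact: distribution_set1.
by apply/seteqP; split=> y; rewrite /xsection/= inE /D/= => ->.
Qed.

End NoTies.

(** * The rank of a new item is uniform *)

Lemma measure_ord_partition d (T : measurableType d) (R : realType)
    (mu : {measure set T -> \bar R}) n (F : nat -> set T) (A : set T) :
  (forall k, (k < n)%N -> measurable (F k)) ->
  (forall i j w, (i < n)%N -> (j < n)%N -> F i w -> F j w -> i = j) ->
  (forall w, A w <-> exists2 i, (i < n)%N & F i w) ->
  mu A = (\sum_(i < n) mu (F i))%E.
Proof.
move=> mF tF AF.
have -> : A = \big[setU/set0]_(i < n) F i.
  by rewrite -bigcup_mkord; apply/seteqP; split=> w /AF.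
apply: measure_semi_additive_ord_I => //.
- apply/trivIsetP => i j /= ni nj /eqP ij.
  by apply/seteqP; split => // w [Fi Fj]; apply: ij; exact: tF Fi Fj.
- by apply: bigsetU_measurable => i _; exact: mF.
Qed.

Section UniformRank.
Context d (T : measurableType d) (R : realType) (P : probability T R).
Variable X : nat -> {RV P >-> R}.
Hypothesis indepX : mutually_independent X.
Hypothesis idX : identically_distributed X.
Hypothesis contX : forall i, continuous (cdf (X i)).

Local Notation path w := (fun i => X i w).

(** Measurability with respect to the rank field, phrased as invariance so that one notion serves
    events ([Prop]-valued functions), real functions and random thresholds in [nat]. *)
Definition rank_determined (U : Type) n (f : T -> U) :=
  forall w w', same_ranks n (path w) (path w') -> f w = f w'.

Lemma measurable_rank_determined n (A : set T) :
  rank_determined n A -> measurable A.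
Proof.
move=> detA; apply: (@measurable_same_ranks _ _ _ (fun i => X i) _ n).
  by move=> i; exact: measurable_funPT.
by move=> w w' /detA ->.
Qed.

Local Notation no_ties n := [set w | injective_upto n (path w)].

Lemma rank_determined_no_ties n : rank_determined n (no_ties n).
Proof.
move=> w w' ww'; apply/propext; split; apply: same_ranks_injective_upto => //.
exact: same_ranks_sym.
Qed.

Lemma probability_no_ties n A : measurable A -> P (A `&` no_ties n) = P A.
Proof.
move=> mA; have mN : measurable (no_ties n).
  exact: measurable_rank_determined (rank_determined_no_ties (n := n)).
rewrite [RHS](measureDI P mA mN) [X in (X + _)%E](_ : _ = 0%E) ?add0e//.
apply: measure_negligible; first exact: measurableD.
have : {ae P, forall w, forall i j, i != j -> X i w <> X j w}.
  apply: ae_foralln => i; apply: ae_foralln => j.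
  have [->|ij] := eqVneq i j; first exact: aeW.
  exists [set w | X i w = X j w]; split.
  - apply: (@measurable_rank_determined (maxn i j).+1) => w w'.
    move=> /same_ranksP ww'; rewrite /mkset.
    have [im jm] : (i < (maxn i j).+1)%N /\ (j < (maxn i j).+1)%N.
      by rewrite !ltnS leq_maxl leq_maxr.
    apply/propext; split=> /eqP; rewrite eq_le => /andP[h1 h2]; apply/eqP;
      by rewrite eq_le ?ww' -?ww' ?h1 ?h2// ?ww' ?h1 ?h2.
  - exact: ties_null.
  - by move=> w /= /not_implyP[_ /contrapT].
apply: negligibleS => w [_ /= ninj] inj; apply: ninj => i j _ _ xij.
by apply/eqP; apply: contraPT xij => /inj.
Qed.

(** Recording which old item [i] holds rank [b] turns the exchange of neighbours into the fixed
    transposition of coordinates [i] and [n]. *)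
Definition rank_pair (A : set T) n a b i : set T :=
  [set w | [/\ injective_upto n.+1 (path w), A w,
    rank (path w) n.+1 n = a & rank (path w) n.+1 i = b]].

Lemma rank_determinedW (U : Type) m n (f : T -> U) : (m <= n)%N ->
  rank_determined m f -> rank_determined n f.
Proof. by move=> mn detf w w' /(same_ranks_leq mn)/detf. Qed.

Lemma rank_pair_determined A n a b i : (i < n)%N -> rank_determined n A ->
  rank_determined n.+1 (rank_pair A n a b i).
Proof.
move=> ni detA.
have imp w w' : same_ranks n.+1 (path w) (path w') ->
    rank_pair A n a b i w -> rank_pair A n a b i w'.
  move=> ww' [inj Aw wa wb]; split.
  - exact: same_ranks_injective_upto inj.
  - by rewrite -(detA _ _ (same_ranks_leq (leqnSn n) ww')).
  - by rewrite -ww'.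
  - by rewrite -ww'// ltnW.
move=> w w' ww'; apply/propext; split; apply: imp => //.
exact: same_ranks_sym.
Qed.

Lemma rank_pair_exchange A n a b i : (i < n)%N -> rank_determined n A ->
  b = a.+1 \/ a = b.+1 -> P (rank_pair A n a b i) = P (rank_pair A n b a i).
Proof.
move=> ni detA adj.
have ni1 : (i < n.+1)%N by exact: leqW.
(* [A] is a set of outcomes, while exchangeability concerns sequences. It is replaced by the
   sequences sharing their first [n] ranks with some outcome of [A]; as [A] is determined by these
   ranks, the pullback is [A] again. *)
pose S a' b' : set (@sequences R) := [set x | [/\ injective_upto n.+1 x,
  exists2 w, A w & same_ranks n (path w) x,
  rank x n.+1 n = a' & rank x n.+1 i = b']].
have SE a' b' : rank_pair A n a' b' i = [set w | S a' b' (path w)].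
  apply/seteqP; split=> w /= [inj Aw wa wb]; split => //; first by exists w.
  by have [w' Aw' ww'] := Aw; rewrite -(detA _ _ ww').
have mS a' b' : measurable (S a' b').
  apply: (@measurable_same_ranks _ _ _ (fun j (x : @sequences R) => x j) _ n.+1).
    exact: measurable_coordinate.
  move=> x x' xx' [inj [w Aw wx] xa xb]; split.
  - exact: same_ranks_injective_upto inj.
  - exists w => // k kn; rewrite wx//.
    exact: (same_ranks_leq (leqnSn n) xx').
  - by rewrite -(xx' n).
  - by rewrite -(xx' i).
have swapS a' b' (x : nat -> R) : b' = a'.+1 \/ a' = b'.+1 ->
    S a' b' x -> S b' a' (swap i n x).
  move=> adj' [inj [w Aw wx] xa xb]; split.
  - exact: injective_upto_swap.
  - exists w => // k kn; rewrite wx//; apply: same_ranks_swap => //.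
    by rewrite xa xb.
  - by rewrite rank_swap// eqxx gtn_eqF.
  - by rewrite rank_swap// eqxx.
have swapK (x : nat -> R) : swap i n (swap i n x) = x.
  apply/funext => k; rewrite !swapE; congr x.
  by do ![case: eqP => //] => *; congruence.
rewrite !SE -(exchangeable_swap indepX idX i n (mS a b)); congr (P _).
apply/seteqP; split=> w /=; last by apply: swapS; case: adj; [right|left].
by move=> /(swapS _ _ _ adj); rewrite swapK.
Qed.

(** Without ties exactly one item holds rank [b], and it is an old one because the new item holds
    [a], distinct from [b]. *)
Lemma rank_pair_sum A n a b : rank_determined n A -> a != b -> (0 < b <= n.+1)%N ->
  P (A `&` no_ties n.+1 `&` [set w | rank (path w) n.+1 n = a]) =
  (\sum_(i < n) P (rank_pair A n a b i))%E.
Proof.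
move=> detA ab b1.
apply: (@measure_ord_partition _ _ _ _ n (rank_pair A n a b)) => [i ni|i j w ni nj|w].
- by apply: measurable_rank_determined; exact: rank_pair_determined.
- move=> [inj _ _ ib] [_ _ _ jb]; apply: (rank_inj inj); rewrite ?ib ?jb//; exact: leqW.
- split=> [[[Aw inj] wa]|[i ni [inj Aw wa wb]]]; last by split.
  have [i ni ib] := rank_onto inj b1.
  exists i; last by split.
  move: ni; rewrite ltnS leq_eqVlt => /predU1P[ni|//].
  by move: ab; rewrite -wa -ib ni eqxx.
Qed.

(** Each side is split by the old item holding the other of the two ranks, and the terms are
    exchanged one by one. *)
Lemma rank_step A n a : rank_determined n A -> (a < n)%N ->
  P (A `&` no_ties n.+1 `&` [set w | rank (path w) n.+1 n = a.+1]) =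
  P (A `&` no_ties n.+1 `&` [set w | rank (path w) n.+1 n = a.+2]).
Proof.
move=> detA an.
rewrite (rank_pair_sum (b := a.+2))//; last by rewrite neq_ltn ltnSn.
have a1 : (0 < a.+1 <= n.+1)%N by exact: (leqW an).
rewrite (rank_pair_sum detA _ a1); last by rewrite neq_ltn ltnSn orbT.
by apply: eq_bigr => i _; apply: rank_pair_exchange => //; left.
Qed.

Lemma rank_uniform A n k : rank_determined n A -> (k <= n.+1)%N ->
  P (A `&` [set w | (rank (path w) n.+1 n <= k)%N]) = ((k%:R / n.+1%:R)%:E * P A)%E.
Proof.
move=> detA kn.
have mA : measurable A := measurable_rank_determined detA.
have mN : measurable (no_ties n.+1).
  exact: measurable_rank_determined (rank_determined_no_ties (n := n.+1)).
pose F a := A `&` no_ties n.+1 `&` [set w | rank (path w) n.+1 n = a.+1].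
have mX i : measurable_fun [set: T] (X i) by exact: measurable_funPT.
have mr a : measurable [set w | rank (path w) n.+1 n = a].
  exact: (measurable_rank (Y := fun i => X i)).
have mF a : measurable (F a) by apply: measurableI => //; exact: measurableI.
have FE a : (a <= n)%N -> P (F a) = P (F 0%N).
  elim: a => // a IH an; rewrite -IH 1?ltnW//; apply/esym; exact: rank_step.
have le_sum m : (m <= n.+1)%N ->
    P (A `&` [set w | (rank (path w) n.+1 n <= m)%N]) = (m%:R%:E * P (F 0%N))%E.
  move=> mn; rewrite -(@probability_no_ties n.+1); last first.
    apply: measurableI => //.
    rewrite (_ : [set _ | _] = \bigcup_(a < m.+1) [set w | rank (path w) n.+1 n = a]).
      by apply: bigcup_measurable => a _; exact: mr.
    apply/seteqP; split=> w /=; first by exists (rank (path w) n.+1 n).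
    by move=> [a /= am ->].
  rewrite (@measure_ord_partition _ _ _ _ m F) => [|//|i j w _ _ [_ /= ri] [_ /=]|w].
  - rewrite (eq_bigr (fun=> P (F 0%N))) => [|i _]; last first.
      by apply: FE; rewrite -ltnS (leq_trans (ltn_ord i)).
    rewrite -[P (F 0%N)]fineK ?fin_num_measure// sumEFin sumr_const card_ord.
    by rewrite -EFinM mulr_natl.
  - by rewrite ri => -[].
  - split=> [[[Aw rm] inj]|[a am [[Aw inj] /= ra]]].
    exists (rank (path w) n.+1 n).-1.
      by rewrite (leq_trans _ rm)// prednK// rank_gt0.
    by split=> //=; rewrite prednK// rank_gt0.
  by split => //; split => //=; rewrite ra.
rewrite le_sum//.
(* A rank never exceeds [n + 1], so this threshold gives all of [A] and identifies the common
   probability as [P A / (n + 1)]. *)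
have := le_sum n.+1 (leqnn _).
rewrite (_ : A `&` _ = A); last first.
  by apply/seteqP; split=> w /= => [[]//|Aw]; split => //; exact: rank_leq.
move=> ->; rewrite -[P (F 0%N)]fineK ?fin_num_measure// -!EFinM.
by rewrite mulrA divfK.
Qed.

End UniformRank.

(** * Moments *)

Section BoundedMeasurable.
Context d (T : measurableType d) (R : realType) (P : probability T R).
Implicit Types f g : T -> R.

(** Every real function of finitely many ranks is of this kind; the class is closed under sums and
    products, so moments are real integrals with integrability at hand. *)
Definition bounded_measurable f :=
  measurable_fun [set: T] f /\ exists C, forall w, `|f w| <= C.

Lemma bounded_measurable_integrable f : bounded_measurable f ->
  P.-integrable [set: T] (EFin \o f).
Proof.
move=> [mf [C fC]]; apply: measurable_bounded_integrable => //.
  by rewrite (le_lt_trans (probability_le1 P measurableT))// ltry.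
exists C; split; first exact: num_real.
by move=> M CM w _ /=; exact: le_trans (fC w) (ltW CM).
Qed.

Lemma bounded_measurable_cst (c : R) : bounded_measurable (fun=> c).
Proof. by split; [exact: measurable_cst|exists `|c|]. Qed.

Lemma bounded_measurableD f g : bounded_measurable f -> bounded_measurable g ->
  bounded_measurable (fun w => f w + g w).
Proof.
move=> [mf [C fC]] [mg [D gD]]; split; first exact: measurable_funD.
by exists (C + D) => w; rewrite (le_trans (ler_normD _ _))// lerD.
Qed.

Lemma bounded_measurableM f g : bounded_measurable f -> bounded_measurable g ->
  bounded_measurable (fun w => f w * g w).
Proof.
move=> [mf [C fC]] [mg [D gD]]; split; first exact: measurable_funM.
by exists (C * D) => w; rewrite normrM ler_pM.
Qed.

Lemma bounded_measurableB f g : bounded_measurable f -> bounded_measurable g ->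
  bounded_measurable (fun w => f w - g w).
Proof.
move=> bf /(bounded_measurableM (bounded_measurable_cst (-1))) bg.
rewrite (_ : (fun w => _) = fun w => f w + -1 * g w); last first.
  by apply/funext => w; rewrite mulN1r.
exact: bounded_measurableD.
Qed.

Lemma bounded_measurable_indic (A : set T) : measurable A ->
  bounded_measurable (\1_A : T -> R).
Proof.
move=> mA; split; first exact: measurable_indic.
by exists 1 => w; rewrite indicE normr_nat; case: (_ \in _).
Qed.

Lemma bounded_measurable_sum (I : Type) (s : seq I) (f : I -> T -> R) :
  (forall i, bounded_measurable (f i)) ->
  bounded_measurable (fun w => \sum_(i <- s) f i w).
Proof.
move=> bf; elim: s => [|i s IH].
  rewrite (_ : (fun w => _) = fun=> 0); first exact: bounded_measurable_cst.
  by apply/funext => w; rewrite big_nil.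
rewrite (_ : (fun w => _) = fun w => f i w + \sum_(j <- s) f j w).
  exact: bounded_measurableD.
by apply/funext => w; rewrite big_cons.
Qed.

Lemma Rintegral_bmD f g : bounded_measurable f -> bounded_measurable g ->
  \int[P]_w (f w + g w) = \int[P]_w f w + \int[P]_w g w.
Proof.
by move=> bf bg; apply: RintegralD => //; exact: bounded_measurable_integrable.
Qed.

Lemma Rintegral_bmZ f (c : R) : bounded_measurable f ->
  \int[P]_w (c * f w) = c * \int[P]_w f w.
Proof. by move=> bf; apply: RintegralZl => //; exact: bounded_measurable_integrable. Qed.

Lemma Rintegral_bm_le f g : bounded_measurable f -> bounded_measurable g ->
  (forall w, f w <= g w) -> \int[P]_w f w <= \int[P]_w g w.
Proof.
by move=> bf bg fg; apply: le_Rintegral => //; exact: bounded_measurable_integrable.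
Qed.

Lemma Rintegral_bm_sum (I : Type) (s : seq I) (f : I -> T -> R) :
  (forall i, bounded_measurable (f i)) ->
  \int[P]_w (\sum_(i <- s) f i w) = \sum_(i <- s) \int[P]_w f i w.
Proof.
move=> bf; elim: s => [|i s IH].
  rewrite big_nil; under eq_Rintegral do rewrite big_nil.
  by rewrite Rintegral_cst// mul0r.
rewrite big_cons -IH -Rintegral_bmD//; last exact: bounded_measurable_sum.
by apply: eq_Rintegral => w _; rewrite big_cons.
Qed.

Lemma Rintegral_bm_cst (c : R) : \int[P]_w c = c.
Proof. 
rewrite Rintegral_cst// -[RHS]mulr1; congr (_ * _).
exact: (congr1 fine (probability_setT P)). Qed.

Lemma Rintegral_bm_indic (A : set T) : measurable A ->
  \int[P]_w \1_A w = fine (P A).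
Proof. by move=> mA; rewrite /Rintegral integral_indic// setIT. Qed.

End BoundedMeasurable.

(** * Integration over rank patterns *)

Section RankDetermined.
Context d (T : measurableType d) (R : realType) (P : probability T R).
Variable X : nat -> {RV P >-> R}.

Local Notation path w := (fun i => X i w).

(** The rank vector in a finite type, over which sums can be taken; [inord] loses nothing because
    ranks are at most [n]. *)
Definition rank_code n (w : T) : {ffun 'I_n -> 'I_n.+1} :=
  [ffun i : 'I_n => inord (rank (path w) n i)].

Lemma rank_codeP n w w' :
  rank_code n w = rank_code n w' <-> same_ranks n (path w) (path w').
Proof.
split=> [/ffunP ww' i ni|ww']; last by apply/ffunP => i; rewrite !ffunE ww'.
have := ww' (Ordinal ni); rewrite !ffunE => /(congr1 val) /=.
by rewrite !inordK// ltnS rank_leq.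
Qed.

(** [get] picks a representative outcome for each attained rank pattern and an arbitrary point for
    the others. *)
Lemma rank_determined_factor (U : pointedType) n (f : T -> U) :
  rank_determined X n f -> exists c, forall w, f w = c (rank_code n w).
Proof.
move=> detf; exists (fun v => f (get [set w | rank_code n w = v])) => w.
apply: detf; apply/rank_codeP.
by apply/esym; apply: (@getI _ [set w' | rank_code n w' = rank_code n w] w).
Qed.

Lemma rank_determined_code n v : rank_determined X n [set w | rank_code n w = v].
Proof. by move=> w w' /rank_codeP e; apply/propext; rewrite /mkset e. Qed.

Lemma bounded_measurable_rank_determined n (f : T -> R) :
  rank_determined X n f -> bounded_measurable f.
Proof.
move=> detf; split.
  move=> _ B mB; rewrite setTI; apply: (measurable_rank_determined (X := X) (n := n)).
  by move=> w w' /detf e; apply/propext; rewrite /preimage /mkset e.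
have [c fc] := rank_determined_factor detf.
exists (\sum_v `|c v|) => w; rewrite fc (bigD1 (rank_code n w))//= lerDl.
by rewrite sumr_ge0.
Qed.

Hypothesis indepX : mutually_independent X.
Hypothesis idX : identically_distributed X.
Hypothesis contX : forall i, continuous (cdf (X i)).

(** On each rank pattern [f] and the threshold [k] are constant, so [rank_uniform] applies pattern
    by pattern. *)
Lemma Rintegral_rank_le n (f : T -> R) (k : T -> nat) :
  rank_determined X n f -> rank_determined X n k -> (forall w, (k w <= n.+1)%N) ->
  \int[P]_w (f w * (rank (path w) n.+1 n <= k w)%N%:R) =
  \int[P]_w (f w * ((k w)%:R / n.+1%:R)).
Proof.
move=> detf detk kn.
have [c fc] := rank_determined_factor detf.
have [h0 kh0] := rank_determined_factor detk.
(* On patterns that no outcome attains [h0] may exceed [n + 1]; truncation gives [rank_uniform] an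
   admissible threshold everywhere. *)
pose h v := minn (h0 v) n.+1.
have kh w : k w = h (rank_code n w) by rewrite /h -kh0; apply/esym/minn_idPl.
pose A v := [set w | rank_code n w = v].
have mA v : measurable (A v) := measurable_rank_determined (rank_determined_code v).
pose r v := [set w | (rank (path w) n.+1 n <= h v)%N].
have mr v : measurable (r v).
  apply: (measurable_rank_determined (X := X) (n := n.+1)) => w w' ww'.
  by apply/propext; rewrite /r /mkset ww'.
have sumE (g : {ffun 'I_n -> 'I_n.+1} -> R) (B : {ffun 'I_n -> 'I_n.+1} -> set T) w :
    (forall v, rank_code n w <> v -> ~ B v w) ->
    \sum_v g v * \1_(B v) w = g (rank_code n w) * \1_(B (rank_code n w)) w.
  move=> notB; rewrite (bigD1 (rank_code n w))//= big1 ?addr0// => v.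
  by move=> /eqP/nesym/notB Bw; rewrite indicE memNset// mulr0.
transitivity (\int[P]_w \sum_v c v * \1_(A v `&` r v) w).
  apply: eq_Rintegral => w _; rewrite sumE => [|v neq [/neq]//].
  rewrite fc kh indicE; congr (_ * _%:R); apply/esym.
  by case: leqP => rk; [rewrite mem_set|rewrite memNset// => -[_]; rewrite /r/= leqNgt rk].
transitivity (\int[P]_w \sum_v c v * ((h v)%:R / n.+1%:R) * \1_(A v) w); last first.
  apply: eq_Rintegral => w _; rewrite sumE => [|v neq /neq//].
  by rewrite fc kh indicE mem_set// mulr1.
have bA v := bounded_measurable_indic R (mA v).
have bAr v := bounded_measurable_indic R (measurableI _ _ (mA v) (mr v)).
rewrite !Rintegral_bm_sum; last 2 first.
- by move=> v; apply: bounded_measurableM => //; exact: bounded_measurable_cst.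
- by move=> v; apply: bounded_measurableM => //; exact: bounded_measurable_cst.
apply: eq_bigr => v _; rewrite !Rintegral_bmZ// !Rintegral_bm_indic//; last exact: measurableI.
rewrite -mulrA; congr (_ * _).
have hn : (h v <= n.+1)%N by exact: geq_minr.
rewrite (rank_uniform indepX idX contX (rank_determined_code v) hn) fineM//.
by rewrite fin_num_measure//; exact: mA.
Qed.

End RankDetermined.

(** * The retention rule as a recursion *)

Section Quota.
Context {R : realType}.
Implicit Types (p : R) (x : nat -> R) (l n : nat).

Definition quota p l : nat := `|Num.ceil (p * l%:R)|%N.

Lemma quotaE p l : 0 <= p -> (quota p l)%:Z = Num.ceil (p * l%:R).
Proof.
move=> p0; rewrite /quota gez0_abs// ceil_ge0.
by rewrite (lt_le_trans (ltrN10 R))// mulr_ge0.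
Qed.

Lemma quota_bounds p l : 0 <= p -> p * l%:R <= (quota p l)%:R <= p * l%:R + 1.
Proof.
move=> p0; have := ceil_itv (p * l%:R); rewrite -quotaE//.
by rewrite -pmulrn intrB -pmulrn => /andP[h ->]; rewrite -lerBlDr ltW.
Qed.

Lemma quota_leq p l : 0 <= p -> p <= 1 -> (quota p l <= l)%N.
Proof.
move=> p0 p1; rewrite -lez_nat quotaE// ceil_le_int -pmulrn.
by rewrite -{2}[l%:R]mul1r ler_wpM2r.
Qed.

(** The uniform form of the rule starts at [n = 1]: the first item is retained although the quota of
    an empty list is 0. Positivity of times in later lemmas comes from here. *)
Lemma retainedS p x n : 0 <= p -> (0 < n)%N -> retained p x n.+1 =
  (retained p x n + (rank x n.+1 n <= quota p (retained p x n)))%N.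
Proof.
move=> p0 n0 /=; rewrite gtn_eqF//= -quotaE//.
Qed.

End Quota.

Section Moments.
Context d (T : measurableType d) (R : realType) (P : probability T R).
Variable X : nat -> {RV P >-> R}.
Hypothesis indepX : mutually_independent X.
Hypothesis idX : identically_distributed X.
Hypothesis contX : forall i, continuous (cdf (X i)).
Variable p : R.
Hypotheses (p_gt0 : 0 < p) (p_le1 : p <= 1).

Local Notation path w := (fun i => X i w).
Local Notation L := (num_retained p X).
Local Notation b := (growth p).

Let p_ge0 : 0 <= p := ltW p_gt0.
Let b_gt0 n : 0 < b n := growth_gt0 n p_ge0.

(** For [n >= 1], the conditional probability given the first [n] ranks that the next item is
    retained. *)
Definition retention_rate n w : R :=
  (quota p (retained p (path w) n))%:R / n.+1%:R.
Local Notation q := retention_rate.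

Lemma num_retained_determined m n : (m <= n)%N -> rank_determined X n (L m).
Proof.
move=> mn w w' /(same_ranks_leq mn)/(same_ranks_retained p).
by rewrite /num_retained => ->.
Qed.

Lemma retention_rate_determined n : rank_determined X n (q n).
Proof. by move=> w w' /(same_ranks_retained p); rewrite /q => ->. Qed.

Lemma num_retained_ge0 n w : 0 <= L n w.
Proof. exact: ler0n. Qed.

Lemma num_retained_leq n w : L n w <= n%:R.
Proof. by rewrite ler_nat retained_leq. Qed.

Lemma num_retained_homo w : {homo (L ^~ w) : m n / (m <= n)%N >-> m <= n}.
Proof. by move=> m n mn; rewrite ler_nat; exact: retained_homo. Qed.

Lemma retention_rate_bounds n w :
  p * L n w / n.+1%:R <= q n w <= (p * L n w + 1) / n.+1%:R.
Proof.
have /andP[h1 h2] := quota_bounds (retained p (path w) n) p_ge0.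
by apply/andP; split; rewrite ler_wpM2r ?invr_ge0.
Qed.

Lemma bounded_measurable_num_retained n : bounded_measurable (L n).
Proof. exact: bounded_measurable_rank_determined (num_retained_determined (leqnn n)). Qed.

(** The identity [E(L_(n+1) - L_n | F_n) = q_n] tested against [g]. The summand [f] lets an
    expression affine in the increment be rewritten at once. *)
Lemma Rintegral_step n (f g : T -> R) : (0 < n)%N ->
  rank_determined X n f -> rank_determined X n g ->
  \int[P]_w (f w + g w * (L n.+1 w - L n w)) = \int[P]_w (f w + g w * q n w).
Proof.
move=> n0 detf detg.
have bf := bounded_measurable_rank_determined detf.
have bg := bounded_measurable_rank_determined detg.
have bq := bounded_measurable_rank_determined (retention_rate_determined (n := n)).
rewrite Rintegral_bmD//; last first.
  apply: bounded_measurableM => //.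
  by apply: bounded_measurableB; exact: bounded_measurable_num_retained.
rewrite Rintegral_bmD//; last exact: bounded_measurableM.
congr (_ + _); rewrite /q.
rewrite -(Rintegral_rank_le indepX idX contX (k := fun w => quota p (retained p (path w) n)))//.
- apply: eq_Rintegral => w _; congr (_ * _).
  by rewrite /num_retained retainedS// natrD addrAC subrr add0r.
- by move=> w w' /(same_ranks_retained p) ->.
- move=> w; apply: leq_trans (quota_leq _ p_ge0 p_le1) _.
  exact: leq_trans (retained_leq _ _ _) (leqnSn n).
Qed.

(** The ceiling only rounds up, so the drift of [L_n] is at least [p * L_n / (n + 1)], which [b_n]
    compensates exactly. *)
Lemma mean_lower n : (0 < n)%N ->
  \int[P]_w L n w / b n <= \int[P]_w L n.+1 w / b n.+1.
Proof.
move=> n0; have bL := bounded_measurable_num_retained n.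
have detL := num_retained_determined (leqnn n).
have bq := bounded_measurable_rank_determined (retention_rate_determined (n := n)).
have -> : \int[P]_w L n.+1 w = \int[P]_w (L n w + 1 * q n w).
  rewrite -Rintegral_step//; apply: eq_Rintegral => w _.
  by rewrite mul1r addrC subrK.
rewrite ler_pdivrMr// mulrAC ler_pdivlMr// growthS mulrCA mulrC ler_wpM2r ?(ltW (b_gt0 _))//.
rewrite mulrC -Rintegral_bmZ//.
apply: Rintegral_bm_le.
- by apply: bounded_measurableM => //; exact: bounded_measurable_cst.
- apply: bounded_measurableD => //; apply: bounded_measurableM => //.
  exact: bounded_measurable_cst.
- move=> w; have /andP[h _] := retention_rate_bounds n w.
  by rewrite mulrDl !mul1r lerD2l mulrAC.
Qed.

(** The shift [1 / p] absorbs the rounding: [p * (L + 1 / p) = p * L + 1] dominates the ceiling. The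
    weight [f] is 1 for the bound on means and an indicator at time [m] for nondegeneracy. *)
Lemma weighted_mean_upper m n (f : T -> R) : (0 < m <= n)%N ->
  rank_determined X m f -> (forall w, 0 <= f w) ->
  \int[P]_w (f w * (L n w + p^-1)) / b n <= \int[P]_w (f w * (L m w + p^-1)) / b m.
Proof.
move=> /andP[m0]; elim: n => [|n IH].
  by rewrite leqn0 => /eqP mE; rewrite mE in m0.
rewrite leq_eqVlt => /predU1P[->//|]; rewrite ltnS => mn detf f0.
apply: le_trans (IH mn detf f0).
have n0 : (0 < n)%N by exact: leq_trans mn.
have detfn : rank_determined X n f := rank_determinedW mn detf.
have detL := num_retained_determined (leqnn n).
have bf := bounded_measurable_rank_determined detf.
have bL := bounded_measurable_num_retained n.
have bq := bounded_measurable_rank_determined (retention_rate_determined (n := n)).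
have bc c := @bounded_measurable_cst _ T R c.
have -> : \int[P]_w (f w * (L n.+1 w + p^-1)) =
    \int[P]_w (f w * (L n w + p^-1) + f w * q n w).
  rewrite -Rintegral_step// => [|w w' ww']; last by rewrite (detfn _ _ ww') (detL _ _ ww').
  apply: eq_Rintegral => w _; ring.
rewrite ler_pdivrMr// mulrAC ler_pdivlMr// growthS [leRHS]mulrCA [leLHS]mulrC.
rewrite ler_wpM2l ?(ltW (b_gt0 _))// mulrC -Rintegral_bmZ//; last first.
  by apply: bounded_measurableM => //; exact: bounded_measurableD.
apply: Rintegral_bm_le.
- apply: bounded_measurableD; apply: bounded_measurableM => //.
  exact: bounded_measurableD.
- apply: bounded_measurableM => //; apply: bounded_measurableM => //.
  exact: bounded_measurableD.
- move=> w; rewrite -mulrDr mulrCA ler_wpM2l// [leRHS]mulrDl mul1r lerD2l.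
  have /andP[_ h] := retention_rate_bounds n w.
  apply: le_trans h _; rewrite mulrAC mulrDr divff ?gt_eqF//.
Qed.

Local Notation S n w := (L n w / b n).

(** Started at time 1, where [L_1 = 1] and [b_1 = 1 + p], the supermartingale bound is
    [(1 + 1 / p) / (1 + p) = 1 / p]. *)
Lemma mean_bound n : \int[P]_w S n w <= p^-1.
Proof.
have bL k := bounded_measurable_num_retained k.
have -> : \int[P]_w S n w = \int[P]_w L n w / b n.
  rewrite [RHS]mulrC -Rintegral_bmZ//.
  by apply: eq_Rintegral => w _; rewrite mulrC.
case: n => [|n].
  rewrite (_ : (fun w => _) = fun=> 0); last by apply/funext => w.
  by rewrite Rintegral_bm_cst mul0r invr_ge0.
have bc c := @bounded_measurable_cst _ T R c.
have /= := @weighted_mean_upper 1 n.+1 (fun=> 1) isT (fun _ _ _ => erefl) (fun=> ler01).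
have -> : \int[P]_w (1 * (L 1 w + p^-1)) = 1 + p^-1.
  transitivity (\int[P]_w (1 + p^-1)); last by rewrite Rintegral_bm_cst.
  by apply: eq_Rintegral => w _; rewrite mul1r.
have -> : b 1 = 1 + p by rewrite growthS /growth big_ord0 mul1r divr1.
have -> : (1 + p^-1) / (1 + p) = p^-1.
  by field; rewrite !gt_eqF// addr_gt0.
apply: le_trans; rewrite ler_wpM2r ?invr_ge0 ?(ltW (b_gt0 _))//.
apply: Rintegral_bm_le => //.
  by apply: bounded_measurableM => //; exact: bounded_measurableD.
by move=> w; rewrite mul1r lerDl invr_ge0.
Qed.

(** One step costs at most [((2 + 2 * p) * S_n + 1) / ((n + 1) * b_(n+1))]. As [E S_n <= 1 / p], the
    numerator has mean at most [3 + 2 / p]; telescoping contributes the last division by [p]. *)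
Definition variance_constant : R := (3 + 2 / p) / p.

Lemma second_moment m n : (0 < m <= n)%N ->
  \int[P]_w ((S n w - S m w) ^+ 2) <= variance_constant * ((b m)^-1 - (b n)^-1).
Proof.
move=> /andP[m0]; elim: n => [|n IH].
  by rewrite leqn0 => /eqP mE; rewrite mE in m0.
rewrite leq_eqVlt => /predU1P[->|].
  rewrite subrr mulr0 (_ : (fun w => _) = fun=> 0) ?Rintegral_bm_cst//.
  by apply/funext => w; rewrite subrr expr0n.
rewrite ltnS => mn.
have n0 : (0 < n)%N by exact: leq_trans mn.
have bq := bounded_measurable_rank_determined (retention_rate_determined (n := n)).
have bc c := @bounded_measurable_cst _ T R c.
have bL k := bounded_measurable_num_retained k.
have detL := num_retained_determined (leqnn n).
have detLm := num_retained_determined mn.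
set B := b n.+1; have B0 : 0 < B by exact: b_gt0.
have B1 : 1 <= B by exact: growth_ge1.
have bB : b n <= B by apply: growth_homo.
pose g w := S n w - S m w.
pose a w := p * L n w / n.+1%:R.
(* With [a] the drift compensated by [b_n], the new difference is [g + (dL - a) / B], where [dL] is
   the increment of [L]. Since [dL] is 0 or 1, [dL^2 = dL], and the square becomes [f0 + f1 * dL],
   affine in [dL]. *)
pose f0 w := g w ^+ 2 - 2 * g w * a w / B + a w ^+ 2 / B ^+ 2.
pose f1 w := 2 * g w / B + (1 - 2 * a w) / B ^+ 2.
have detg : rank_determined X n g.
  by move=> w w' ww'; rewrite /g (detL _ _ ww') (detLm _ _ ww').
have deta : rank_determined X n a by move=> w w' ww'; rewrite /a (detL _ _ ww').
have det0 : rank_determined X n f0.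
  by move=> w w' ww'; rewrite /f0 (detg _ _ ww') (deta _ _ ww').
have det1 : rank_determined X n f1.
  by move=> w w' ww'; rewrite /f1 (detg _ _ ww') (deta _ _ ww').
have bg := bounded_measurable_rank_determined detg.
have N0 : 0 < n.+1%:R :> R by [].
have -> : \int[P]_w ((S n.+1 w - S m w) ^+ 2) = \int[P]_w (f0 w + f1 w * q n w).
  rewrite -Rintegral_step//; apply: eq_Rintegral => w _.
  have -> : S n.+1 w - S m w = g w + (L n.+1 w - L n w - a w) / B.
    rewrite /g -/B; have -> : S n w = (L n w + a w) / B.
      rewrite /a /B growthS; field.
      by rewrite !gt_eqF//= addr_gt0.
    ring.
  have xi2 : (L n.+1 w - L n w) ^+ 2 = L n.+1 w - L n w.
    rewrite /num_retained retainedS// natrD addrAC subrr add0r.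
    by case: (_ <= _)%N; rewrite ?expr1n ?expr0n.
  have -> : (g w + (L n.+1 w - L n w - a w) / B) ^+ 2 = g w ^+ 2 +
      2 * g w * (L n.+1 w - L n w - a w) / B + ((L n.+1 w - L n w) ^+ 2
      - 2 * a w * (L n.+1 w - L n w) + a w ^+ 2) / B ^+ 2.
    by field; rewrite gt_eqF.
  rewrite xi2 /f0 /f1; field.
  by rewrite gt_eqF.
(* The cross term is controlled by [0 <= q - a <= 1 / (n + 1)] and [g <= S_n], the quadratic term by
   [2 * a + 1 / (n + 1)] together with [a / B <= p * S_n / (n + 1)]. *)
pose h w := g w ^+ 2 + ((2 + 2 * p) * S n w + 1) / (n.+1%:R * B).
have bS k : bounded_measurable (fun w => S k w) by exact: bounded_measurableM.
have bh : bounded_measurable h.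
  apply: bounded_measurableD.
    by apply: (@bounded_measurable_rank_determined _ _ _ _ X n) => w w' /detg ->.
  apply: bounded_measurableM => //; apply: bounded_measurableD => //.
  exact: bounded_measurableM.
have bf : bounded_measurable (fun w => f0 w + f1 w * q n w).
  apply: bounded_measurableD; first exact: bounded_measurable_rank_determined det0.
  by apply: bounded_measurableM => //; exact: bounded_measurable_rank_determined det1.
apply: (@le_trans _ _ (\int[P]_w h w)).
  apply: Rintegral_bm_le => // w.
  have /andP[q1 q2] := retention_rate_bounds n w.
  have aq : a w <= q n w by [].
  have qa : q n w <= a w + n.+1%:R^-1 by rewrite /a -[X in _ + X]mul1r -mulrDl.
  have Ln := num_retained_leq n w.
  have a0 : 0 <= a w by rewrite /a divr_ge0// mulr_ge0.
  have a1 : a w <= 1.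
    rewrite /a ler_pdivrMr// mul1r (@le_trans _ _ (L n w))//.
      by rewrite ler_piMl.
    by rewrite (le_trans Ln)// ler_nat.
  have gS : g w <= S n w by rewrite /g gerBl divr_ge0// ltW.
  have S0 : 0 <= S n w by rewrite divr_ge0// ltW.
  have aS : a w <= p * S n w * B / n.+1%:R.
    rewrite /a ler_wpM2r ?invr_ge0// -mulrA ler_wpM2l//.
    rewrite mulrAC ler_pdivlMr// ler_wpM2l//.
  rewrite /h /f0 /f1.
  move: (S n w) (g w) (a w) (q n w) gS S0 aS a0 a1 aq qa {q1 q2}.
  move=> s y u v ys s0 us u0 u1 uv vu.
  rewrite (_ : y ^+ 2 - 2 * y * u / B + u ^+ 2 / B ^+ 2 +
    (2 * y / B + (1 - 2 * u) / B ^+ 2) * v = y ^+ 2 +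
    (2 * y * (v - u) / B + (v - 2 * u * v + u ^+ 2) / B ^+ 2)); last first.
    by field; rewrite gt_eqF.
  rewrite -exprVn invfM; set i := n.+1%:R^-1 in us vu *; set c := B^-1.
  have i0 : 0 < i by rewrite invr_gt0.
  have c0 : 0 < c by rewrite invr_gt0.
  have c1 : c <= 1 by rewrite invf_le1.
  rewrite lerD2l.
  have e1 : y * (v - u) <= s * i.
    apply: (@le_trans _ _ (s * (v - u))); first by rewrite ler_wpM2r// subr_ge0.
    by rewrite ler_wpM2l// lerBlDr addrC.
  have e2 : v - 2 * u * v + u ^+ 2 <= 2 * u + i by nra.
  have e3 : u * c <= p * s * i.
    by rewrite /c ler_pdivrMr// mulrAC.
  have e4 : (2 * u + i) * c ^+ 2 <= (2 * p * s * i + i) * c.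
    rewrite expr2 mulrA ler_wpM2r// ?(ltW c0)// mulrDl.
    apply: lerD; first by rewrite -!mulrA ler_wpM2l// mulrA.
    by rewrite ler_piMr// ltW.
  apply: (@le_trans _ _ (2 * (s * i) * c + (2 * p * s * i + i) * c)); last first.
    by rewrite le_eqVlt; apply/orP; left; apply/eqP; ring.
  apply: lerD.
    by rewrite ler_wpM2r ?(ltW c0)// -mulrA ler_wpM2l.
  by apply: le_trans e4; rewrite ler_wpM2r// exprn_ge0// ltW.
rewrite Rintegral_bmD//; last 2 first.
- by apply: (@bounded_measurable_rank_determined _ _ _ _ X n) => w w' /detg ->.
- apply: bounded_measurableM => //; apply: bounded_measurableD => //.
  exact: bounded_measurableM.
have -> : \int[P]_w (((2 + 2 * p) * S n w + 1) / (n.+1%:R * B)) =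
    (n.+1%:R * B)^-1 * ((2 + 2 * p) * \int[P]_w S n w + 1).
  have <- : \int[P]_w ((2 + 2 * p) * S n w + 1) = (2 + 2 * p) * \int[P]_w S n w + 1.
    rewrite Rintegral_bmD//; last exact: bounded_measurableM.
    by rewrite Rintegral_bmZ// Rintegral_bm_cst.
  rewrite -Rintegral_bmZ; last first.
    by apply: bounded_measurableD => //; exact: bounded_measurableM.
  by apply: eq_Rintegral => w _; rewrite mulrC.
apply: (@le_trans _ _ (variance_constant * ((b m)^-1 - (b n)^-1) +
    (n.+1%:R * B)^-1 * ((2 + 2 * p) / p + 1))).
  apply: lerD; first exact: IH.
  rewrite ler_wpM2l ?invr_ge0 ?mulr_ge0// ?(ltW B0)// lerD2r ler_wpM2l ?addr_ge0 ?mulr_ge0//.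
  exact: mean_bound.
rewrite growth_telescope// /variance_constant le_eqVlt; apply/orP; left; apply/eqP.
by rewrite -/B; field; rewrite !gt_eqF.
Qed.

End Moments.

(** * The submartingale property *)

Section Submartingale.
Context d (T : measurableType d) (R : realType) (P : probability T R).
Variable X : nat -> {RV P >-> R}.
Hypothesis indepX : mutually_independent X.
Hypothesis idX : identically_distributed X.
Hypothesis contX : forall i, continuous (cdf (X i)).
Variable p : R.
Hypotheses (p_gt0 : 0 < p) (p_le1 : p <= 1).

Local Notation path w := (fun i => X i w).
Local Notation L := (num_retained p X).
Local Notation q := (retention_rate X p).

Lemma rank_field_determined n (A : set T) :
  rank_field X n A <-> rank_determined X n A.
Proof.
split=> [/rank_fieldP detA w w' ww'|detA].
  apply/propext; split; apply: detA => //; exact: same_ranks_sym.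
by apply/rank_fieldP => w w' /detA ->.
Qed.

Lemma filtration_rank_field : filtration (fun n => rank_field X n.+1).
Proof.
split=> [n|n A /rank_field_determined|m n mn A].
- exact: smallest_sigma_algebra.
- exact: measurable_rank_determined.
- move=> /rank_field_determined detA; apply/rank_field_determined.
  exact: rank_determinedW detA.
Qed.

Lemma measurable_wrt_rank_field n (f : T -> R) :
  rank_determined X n f -> measurable_wrt (rank_field X n) f.
Proof.
move=> detf _ [B mB <-]; apply/rank_field_determined => w w' /detf e.
by apply/propext; rewrite setTI /preimage /mkset e.
Qed.

Lemma integral_bounded_in (A : set T) (f : T -> R) : measurable A ->
  bounded_measurable f ->
  (\int[P]_(w in A) (f w)%:E)%E = (\int[P]_w (\1_A w * f w))%:E.
Proof.
move=> mA bf; rewrite integral_mkcond /Rintegral fineK; last first.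
  apply: integrable_fin_num => //; apply: bounded_measurable_integrable.
  by apply: bounded_measurableM => //; exact: bounded_measurable_indic.
apply: eq_integral => w _; rewrite /patch indicE.
by case: ifP => _; rewrite ?mul1r ?mul0r.
Qed.

Lemma submartingale_num_retained : submartingale P (fun n => rank_field X n.+1)
  (fun n w => L n.+1 w / n.+2%:R `^ p).
Proof.
have p01 : 0 <= p <= 1 by rewrite ltW.
have detL n m : (m <= n)%N -> rank_determined X n (L m).
  exact: num_retained_determined.
have detM n : rank_determined X n.+1 (fun w => L n.+1 w / n.+2%:R `^ p).
  by move=> w w' ww'; rewrite (detL _ _ (leqnn n.+1) _ _ ww').
split.
- exact: filtration_rank_field.
- by move=> n; exact: measurable_wrt_rank_field.
- by move=> n; exact/bounded_measurable_integrable/bounded_measurable_rank_determined/detM.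
move=> n; pose N : R := n.+3%:R `^ p.
have detq : rank_determined X n.+1 (q n.+1) := @retention_rate_determined _ _ _ _ X p n.+1.
(* The conditional expectation of the next term: the mean increment [q] is added while the
   normalization is already that of the next time. *)
pose Z w := (L n.+1 w + q n.+1 w) / N.
have detZ : rank_determined X n.+1 Z.
  by move=> w w' ww'; rewrite /Z (detL _ _ (leqnn n.+1) _ _ ww') (detq _ _ ww').
exists Z; first split.
- exact: measurable_wrt_rank_field.
- exact/bounded_measurable_integrable/bounded_measurable_rank_determined/detZ.
- move=> A /rank_field_determined detA.
  have mA := measurable_rank_determined detA.
  have bZ := bounded_measurable_rank_determined detZ.
  have bM := bounded_measurable_rank_determined (detM n.+1).
  rewrite (integral_bounded_in mA bZ) (integral_bounded_in mA bM).
  have det1 : rank_determined X n.+1 (fun w => \1_A w / N : R).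
    move=> w w' /detA e; rewrite !indicE.
    by have -> : (w \in A) = (w' \in A) by apply/idP/idP; rewrite !inE e.
  have det2 : rank_determined X n.+1 (fun w => \1_A w / N * L n.+1 w : R).
    by move=> w w' ww'; rewrite (det1 _ _ ww') (detL _ _ (leqnn n.+1) _ _ ww').
  have := @Rintegral_step _ _ _ _ _ indepX idX contX _ p_gt0 p_le1 n.+1
    _ _ isT det2 det1.
  move=> /esym e; congr (_%:E); move: e; congr (_ = _).
    by apply: eq_Rintegral => w _; rewrite /Z; ring.
  by apply: eq_Rintegral => w _; rewrite -/N; ring.
- apply: aeW => w; rewrite /Z /N.
  have /andP[ql _] := retention_rate_bounds X p_gt0 n.+1 w.
  rewrite ler_pdivrMr ?powR_gt0// mulrAC ler_pdivlMr ?powR_gt0//.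
  apply: (@le_trans _ _ (L n.+1 w * (1 + p / n.+2%:R) * n.+2%:R `^ p)); last first.
    by rewrite ler_wpM2r ?powR_ge0// mulrDr mulr1 lerD2l mulrCA mulrA.
  rewrite -mulrA ler_wpM2l ?num_retained_ge0//.
  exact: powR_succ_le.
Qed.

End Submartingale.

(** * Almost sure convergence and the limit *)

Section Convergence.
Context d (T : measurableType d) (R : realType) (P : probability T R).
Variable X : nat -> {RV P >-> R}.
Hypothesis indepX : mutually_independent X.
Hypothesis idX : identically_distributed X.
Hypothesis contX : forall i, continuous (cdf (X i)).
Variable p : R.
Hypotheses (p_gt0 : 0 < p) (p_le1 : p <= 1).

Local Notation path w := (fun i => X i w).
Local Notation L := (num_retained p X).
Local Notation b := (growth p).
Local Notation S n w := (L n w / b n).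
Local Notation M n w := (L n w / n.+1%:R `^ p).

Let p_ge0 : 0 <= p := ltW p_gt0.
Let p01 : 0 <= p <= 1. Proof. by rewrite p_ge0. Qed.
Let b_gt0 n : 0 < b n := growth_gt0 n p_ge0.

Variable e : nat.
Hypothesis e_gt0 : (0 < e)%N.
Hypothesis growth_e : forall k, k.+2%:R ^+ 4 <= b (k.+2 ^ e).-1.

(* The times [(k + 2) ^ e - 1]: consecutive ones have ratio tending to [1], yet
   they grow fast enough for the increments of [S] to be summable. *)
Local Notation s k := ((k.+2 ^ e).-1).

Lemma times_gt0 k : (0 < s k)%N.
Proof.
case: (posnP (s k)) => // sk.
have := growth_e k; rewrite sk /growth big_ord0 => h.
have : 1 < k.+2%:R ^+ 4 :> R by rewrite exprn_egt1// ltr1n.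
by rewrite ltNge h.
Qed.

Lemma times_homo : {homo (fun k => s k) : m n / (m < n)%N}.
Proof.
move=> m n mn; rewrite -ltnS !prednK ?expn_gt0//.
by rewrite ltn_exp2r.
Qed.

Lemma times_cvg (u : nat -> R) (l : R) :
  u n @[n --> \oo] --> l -> u (s k) @[k --> \oo] --> l.
Proof.
have s_ge k : (k <= s k)%N.
  by elim: k => // k IH; exact: leq_ltn_trans IH (times_homo (ltnSn k)).
move=> cu; apply: (@cvg_comp _ _ _ (fun k => s k) u); last exact: cu.
move=> A [N _ NA]; exists N => // k Nk; apply: NA => /=.
exact: leq_trans Nk (s_ge k).
Qed.

Definition gap k w : R := `|S (s k.+1) w - S (s k) w|.

Lemma gap_ge0 k w : 0 <= gap k w.
Proof. exact: normr_ge0. Qed.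

Lemma bounded_measurable_S n : bounded_measurable (fun w => S n w).
Proof.
apply: bounded_measurableM; first exact: bounded_measurable_num_retained.
exact: bounded_measurable_cst.
Qed.

Lemma bounded_measurable_gap k : bounded_measurable (gap k).
Proof.
have [mf [C fC]] := bounded_measurableB (bounded_measurable_S (s k.+1))
  (bounded_measurable_S (s k)).
split; last by exists C => w; rewrite normr_id.
exact: measurableT_comp.
Qed.

Let C0 : R := 1 + variance_constant p.

Lemma variance_constant_ge0 : 0 <= variance_constant p.
Proof. by rewrite divr_ge0// addr_ge0// divr_ge0. Qed.

(** The inequality [x <= 1 / r + r * x^2] with [r = (k + 2)^2] turns the second moment bound
    [O(r^-2)] into a mean [O(1 / r)], and [1 / r] is below the telescoping
    [1 / ((k + 1) * (k + 2))]. *)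
Lemma mean_gap k : \int[P]_w gap k w <= C0 * (k.+1%:R^-1 - k.+2%:R^-1).
Proof.
set r : R := k.+2%:R ^+ 2.
have r0 : 0 < r by rewrite exprn_gt0.
have bc c := @bounded_measurable_cst _ T R c.
have bD := bounded_measurableB (bounded_measurable_S (s k.+1)) (bounded_measurable_S (s k)).
have bD2 : bounded_measurable (fun w => (S (s k.+1) w - S (s k) w) ^+ 2).
  exact: (bounded_measurableM bD bD).
apply: (@le_trans _ _ (\int[P]_w (r^-1 + r * (S (s k.+1) w - S (s k) w) ^+ 2))).
  apply: Rintegral_bm_le => [||w].
  - exact: bounded_measurable_gap.
  - by apply: bounded_measurableD => //; exact: bounded_measurableM.
  - rewrite /gap -[X in _ + r * X]real_normK ?num_real//.
    move: `|_| (normr_ge0 (S (s k.+1) w - S (s k) w)) => x x0.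
    have ri : r * r^-1 = 1 by rewrite divff// gt_eqF.
    have i0 : 0 <= r^-1 by rewrite invr_ge0 ltW.
    have := sqr_ge0 (r * x - 1).
    have -> : (r * x - 1) ^+ 2 = r * (r * x ^+ 2 - 2 * x + r^-1).
      by rewrite -(divff (lt0r_neq0 r0)); field; rewrite gt_eqF.
    by rewrite pmulr_rge0//; lra.
rewrite Rintegral_bmD//; last exact: bounded_measurableM.
rewrite Rintegral_bm_cst Rintegral_bmZ//.
have sk : (0 < s k <= s k.+1)%N by rewrite times_gt0/= ltnW// times_homo.
have := second_moment indepX idX contX p_gt0 p_le1 sk.
have vb : variance_constant p * ((b (s k))^-1 - (b (s k.+1))^-1) <=
    variance_constant p * (r ^+ 2)^-1.
  rewrite ler_wpM2l ?variance_constant_ge0//.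
  apply: (@le_trans _ _ (b (s k))^-1); first by rewrite gerBl invr_ge0 ltW.
  rewrite lef_pV2 ?posrE ?exprn_gt0//.
  by rewrite /r -exprM; exact: growth_e.
move=> /le_trans/(_ vb)/(ler_wpM2l (ltW r0)) h.
apply: (@le_trans _ _ (C0 * r^-1)).
  rewrite /C0 mulrDl mul1r lerD2l (le_trans h)// mulrCA ler_wpM2l ?variance_constant_ge0//.
  by rewrite expr2 invfM mulrA divff ?mul1r// gt_eqF.
rewrite ler_wpM2l// ?addr_ge0 ?variance_constant_ge0//.
have -> : k.+1%:R^-1 - k.+2%:R^-1 = (k.+1%:R * k.+2%:R)^-1 :> R.
  rewrite -(natr1 k.+1); have : 0 < k.+1%:R :> R by [].
  move: (k.+1%:R) => x x0; field.
  by rewrite !gt_eqF// addr_gt0.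
by rewrite lef_pV2 ?posrE ?mulr_gt0// /r expr2 ler_wpM2r// ler_nat.
Qed.

(** The total variation of [S] along the chosen times. Where it is finite [S] converges along them;
    being integrable, it also serves to dominate. *)
Definition total_gap w : \bar R := (\sum_(0 <= k <oo) (gap k w)%:E)%E.

Lemma integral_total_gap : (\int[P]_w total_gap w < +oo)%E.
Proof.
rewrite /total_gap integral_nneseries//; last 2 first.
- by move=> k; apply/measurable_EFinP; case: (bounded_measurable_gap k).
- by move=> k w _; rewrite lee_fin gap_ge0.
apply: (@le_lt_trans _ _ C0%:E); last exact: ltry.
apply: lime_le.
  by apply: is_cvg_nneseries => k _ _; apply: integral_ge0 => w _; rewrite lee_fin gap_ge0.
apply: nearW => n.
rewrite (eq_bigr (fun k => (\int[P]_w gap k w)%:E)) => [|k _]; last first.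
  rewrite /Rintegral fineK//; apply: integrable_fin_num => //.
  exact/bounded_measurable_integrable/bounded_measurable_gap.
rewrite sumEFin lee_fin.
apply: (@le_trans _ _ (\sum_(0 <= k < n) C0 * (k.+1%:R^-1 - k.+2%:R^-1))).
  by apply: ler_sum => k _; exact: mean_gap.
rewrite -mulr_sumr.
have -> : \sum_(0 <= k < n) (k.+1%:R^-1 - k.+2%:R^-1) = 1 - n.+1%:R^-1 :> R.
  elim: n => [|n IH]; first by rewrite big_geq// invr1 subrr.
  by rewrite big_nat_recr//= IH addrA subrK.
by rewrite ler_piMr ?gerBl ?invr_ge0// addr_ge0// variance_constant_ge0.
Qed.

Lemma measurable_total_gap : measurable_fun [set: T] total_gap.
Proof.
apply: ge0_emeasurable_sum => [k w _ _|k _]; first by rewrite lee_fin gap_ge0.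
by apply/measurable_EFinP; case: (bounded_measurable_gap k).
Qed.

Lemma total_gap_ge0 w : (0 <= total_gap w)%E.
Proof. by apply: nneseries_ge0 => k _ _; rewrite lee_fin gap_ge0. Qed.

Lemma integrable_total_gap : P.-integrable [set: T] total_gap.
Proof.
apply/integrableP; split; first exact: measurable_total_gap.
under eq_integral do rewrite gee0_abs ?total_gap_ge0//.
exact: integral_total_gap.
Qed.

Lemma partial_gap_le n w : ((\sum_(0 <= k < n) gap k w)%:E <= total_gap w)%E.
Proof.
rewrite -sumEFin; apply: nneseries_lim_ge => k _ _.
by rewrite lee_fin gap_ge0.
Qed.

Lemma subsequence_dominated k w : ((S (s k) w)%:E <= (S (s 0) w)%:E + total_gap w)%E.
Proof.
apply: le_trans (leeD2l _ (partial_gap_le k w)); rewrite -EFinD lee_fin.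
elim: k => [|k IH]; first by rewrite big_geq// addr0.
rewrite big_nat_recr//= addrA -lerBlDr; apply: le_trans IH.
by rewrite lerBlDr -lerBlDl ler_norm.
Qed.

Lemma subsequence_cvg w : total_gap w \is a fin_num -> cvgn (fun k => S (s k) w).
Proof.
move=> fin; pose u k := S (s k) w.
have cu : cvgn (series (telescope u)).
  apply: normed_cvg; apply: nondecreasing_is_cvgn.
    apply/nondecreasing_seqP => n.
    by rewrite /= seriesSr lerDl.
  exists (fine (total_gap w)) => _ [n _ <-].
  by rewrite -lee_fin fineK//= seriesEnat; exact: partial_gap_le.
rewrite (_ : (fun k => _) = fun k => series (telescope u) k + u 0%N).
  by apply: is_cvgD => //; exact: is_cvg_cst.
by apply/funext => k; rewrite telescopeK/= subrK.
Qed.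

Lemma times_ratio_cvg : (s k.+1).+1%:R `^ p / (s k).+1%:R `^ p @[k --> \oo] --> (1 : R).
Proof.
apply: (@powR_ratio_cvg1 _ _ (fun k => (s k.+1).+1%:R) (fun k => (s k).+1%:R)) => //.
  by move=> k; rewrite ltr0Sn ler_nat ltnS/= ltnW// times_homo.
rewrite (_ : (fun k => _) = fun k => (1 + k.+2%:R^-1) ^+ e); last first.
  apply/funext => k; rewrite !prednK ?expn_gt0// !natrX -expr_div_n -(natr1 k.+2).
  by rewrite mulrDl divff// mul1r.
have h : k.+2%:R^-1 @[k --> \oo] --> (0 : R).
  by have := @cvg_harmonic R; rewrite -cvg_shiftS.
have h1 : 1 + k.+2%:R^-1 @[k --> \oo] --> (1 : R).
  by rewrite -[X in _ --> X]addr0; apply: cvgD => //; exact: cvg_cst.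
rewrite -[X in _ --> X](expr1n _ e).
exact: (@continuous_cvg _ R R _ _ _ (fun x => x ^+ e) _ (@exprn_continuous R e 1) h1).
Qed.

Lemma ratio_cvg w : total_gap w \is a fin_num -> cvgn (fun n => M n w).
Proof.
move=> fin; have cvS := subsequence_cvg fin.
have [g g0 cvg_g] := growth_ratio_cvg p01.
apply/cvg_ex; exists (limn (fun k => S (s k) w) * g).
apply: (@monotone_ratio_cvg _ _ (fun n => n.+1%:R `^ p) (fun k => s k)).
- by move=> n; exact: num_retained_ge0.
- exact: num_retained_homo.
- by move=> n; rewrite powR_gt0.
- by move=> m n mn; rewrite ge0_ler_powR ?nnegrE// ler_nat.
- exact: times_homo.
- rewrite (_ : (fun k => _) = fun k => S (s k) w * growth_ratio p (s k)).
    by apply: cvgM => //; exact: times_cvg.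
  by apply/funext => k; rewrite /growth_ratio mulrA divfK// gt_eqF.
- exact: times_ratio_cvg.
Qed.

(** The upper limit exists for every outcome, so this is measurable on the whole space; [fine] gives
    0 where it is infinite, and the value is the limit wherever [M] converges. *)
Definition limit_ratio w : R := fine (limn_esup (fun n => (M n w)%:E)).

Lemma bounded_measurable_M n : bounded_measurable (fun w => M n w).
Proof.
apply: bounded_measurableM; first exact: bounded_measurable_num_retained.
exact: bounded_measurable_cst.
Qed.

Lemma measurable_limit_ratio : measurable_fun [set: T] limit_ratio.
Proof.
apply: measurableT_comp => //.
apply: measurable_fun_limn_esup => n.
by apply/measurable_EFinP; case: (bounded_measurable_M n).
Qed.

Lemma limit_ratio_cvg w : cvgn (fun n => M n w) ->
  M n w @[n --> \oo] --> limit_ratio w.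
Proof.
move=> cv; have cvE : (M n w)%:E @[n --> \oo] --> (limn (fun n => M n w))%:E.
  by apply: cvg_EFin; first exact: nearW.
by have [_ h] := cvg_limn_einf_sup cvE; rewrite /limit_ratio h/=.
Qed.

Lemma ae_ratio_cvg : {ae P, forall w, M n w @[n --> \oo] --> limit_ratio w}.
Proof.
have := integrable_ae measurableT integrable_total_gap.
apply: filterS => w /(_ I) fin.
exact/limit_ratio_cvg/ratio_cvg.
Qed.

(** Dominated convergence along the times [s]: [total_gap] controls [S] there, and [1 + p] bounds
    the factor [growth_ratio] between [S] and [M]. Besides the full space, the indicator covers the
    events used against a constant limit. *)
Lemma weighted_mean_cvg (A : set T) : measurable A ->
  P.-integrable [set: T] (fun w => (\1_A w * limit_ratio w)%:E) /\
  \int[P]_w (\1_A w * M (s k) w) @[k --> \oo] --> \int[P]_w (\1_A w * limit_ratio w).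
Proof.
move=> mA.
pose g w := ((1 + p)%:E * ((S (s 0) w)%:E + total_gap w))%E.
have bA := bounded_measurable_indic R mA.
have bf k : bounded_measurable (fun w => \1_A w * M (s k) w).
  by apply: bounded_measurableM => //; exact: bounded_measurable_M.
have ig : P.-integrable [set: T] g.
  apply: integrableZl => //; apply: integrableD => //.
    exact/bounded_measurable_integrable/bounded_measurable_S.
  exact: integrable_total_gap.
have mlim : measurable_fun [set: T] (fun w => (\1_A w * limit_ratio w)%:E).
  apply/measurable_EFinP; apply: measurable_funM => //.
  exact: measurable_limit_ratio.
have cv : {ae P, forall w, [set: T] w ->
    (\1_A w * M (s k) w)%:E @[k --> \oo] --> (\1_A w * limit_ratio w)%:E}.
  move: ae_ratio_cvg; apply: filterS => w cv _.
  apply: cvg_EFin; first exact: nearW.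
  apply: cvgM; first exact: cvg_cst.
  exact: (times_cvg cv).
have dom : {ae P, forall w k, [set: T] w ->
    (`|(\1_A w * M (s k) w)%:E| <= g w)%E}.
  apply: aeW => w k _; rewrite /g.
  apply: le_trans (lee_wpmul2l _ (subsequence_dominated k w)); last by rewrite lee_fin addr_ge0.
  rewrite -EFinM lee_fin.
  have M0 : 0 <= M (s k) w by rewrite divr_ge0 ?powR_ge0// num_retained_ge0.
  rewrite normrM (ger0_norm M0) indicE normr_nat.
  apply: (@le_trans _ _ (M (s k) w)); first by rewrite ler_piMl//; case: (_ \in _).
  have -> : M (s k) w = growth_ratio p (s k) * S (s k) w.
    by rewrite [RHS]mulrC /growth_ratio mulrA divfK// gt_eqF.
  rewrite ler_wpM2r ?growth_ratio_le// divr_ge0 ?num_retained_ge0//.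
  exact: ltW.
have [ilim _ cvi] := @dominated_convergence _ _ _ P _ measurableT
  (fun k w => (\1_A w * M (s k) w)%:E) (fun w => (\1_A w * limit_ratio w)%:E) g
  (fun k => measurable_int _ (bounded_measurable_integrable P (bf k))) mlim cv ig dom.
split => //; apply: fine_cvg; rewrite fineK//.
exact: integrable_fin_num.
Qed.

End Convergence.

(** * Convergence of means and the event of a single retained item *)

Section Limit.
Context d (T : measurableType d) (R : realType) (P : probability T R).
Variable X : nat -> {RV P >-> R}.
Hypothesis indepX : mutually_independent X.
Hypothesis idX : identically_distributed X.
Hypothesis contX : forall i, continuous (cdf (X i)).
Variable p : R.
Hypotheses (p_gt0 : 0 < p) (p_le1 : p <= 1).

Local Notation path w := (fun i => X i w).
Local Notation L := (num_retained p X).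
Local Notation b := (growth p).
Local Notation M n w := (L n w / n.+1%:R `^ p).

Let p_ge0 : 0 <= p := ltW p_gt0.
Let p01 : 0 <= p <= 1. Proof. by rewrite p_ge0. Qed.
Let b_gt0 n : 0 < b n := growth_gt0 n p_ge0.

Lemma expectation_bounded_measurable (f : T -> R) : bounded_measurable f ->
  'E_P[f]%E = (\int[P]_w f w)%:E.
Proof.
move=> bf; rewrite unlock /Rintegral fineK//; apply: integrable_fin_num => //.
exact: bounded_measurable_integrable.
Qed.

(** Monotone and bounded by [1 / p]; the limit is positive because the sequence starts from
    [L_1 = 1]. *)
Lemma mean_cvg : exists2 theta : R, 0 < theta &
  \int[P]_w L n w / b n @[n --> \oo] --> theta.
Proof.
pose u n := \int[P]_w L n.+1 w / b n.+1.
have nd : {homo u : m n / (m <= n)%N >-> m <= n}.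
  by apply/nondecreasing_seqP => n; exact: mean_lower.
have bL n := @bounded_measurable_num_retained _ _ _ _ X p n.
have uE n : u n = \int[P]_w (L n.+1 w / b n.+1).
  rewrite /u [LHS]mulrC -Rintegral_bmZ//.
  by apply: eq_Rintegral => w _; rewrite mulrC.
have cu : cvgn u.
  apply: nondecreasing_is_cvgn => //; exists p^-1 => _ [n _ <-].
  by rewrite uE; exact: mean_bound.
exists (limn u); last by rewrite -cvg_shiftS.
apply: lt_le_trans (nondecreasing_cvgn_le nd cu 0).
rewrite /u divr_gt0//.
rewrite (_ : (fun w => _) = fun=> 1) ?Rintegral_bm_cst//.
Qed.

(** With one item retained among [n], the quota is at most 1, so the next item is rejected with
    conditional probability at least [1 - 1 / (n + 1) > 0]. *)
Lemma probability_one_retained m : (0 < m)%N ->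
  0 < \int[P]_w (\1_[set w | L m w = 1] w : R).
Proof.
case: m => // m _; elim: m => [|m IH].
  rewrite (_ : (fun w => _) = fun=> 1) ?Rintegral_bm_cst//.
  by apply/funext => w; rewrite indicE mem_set.
pose A n : set T := [set w | L n w = 1].
have detL n m' : (m' <= n)%N -> rank_determined X n (L m').
  exact: num_retained_determined.
have det1 n m' : (m' <= n)%N -> rank_determined X n (fun w => \1_(A m') w : R).
  move=> mn w w' ww'; rewrite !indicE.
  have Ae : (w \in A m') = (w' \in A m').
    by apply/idP/idP; rewrite !inE /A /mkset (detL _ _ mn _ _ ww').
  by rewrite Ae.
have detN : rank_determined X m.+1 (fun w => - (\1_(A m.+1) w) : R).
  by move=> w w' ww'; rewrite (det1 _ _ (leqnn _) _ _ ww').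
have := @Rintegral_step _ _ _ _ _ indepX idX contX _ p_gt0 p_le1 m.+1 _ _ isT
  (det1 _ _ (leqnn m.+1)) detN.
have detq := @retention_rate_determined _ _ _ _ X p m.+1.
have b1 n := bounded_measurable_rank_determined (det1 _ _ (leqnn n)).
have bN := bounded_measurable_rank_determined detN.
have bq := bounded_measurable_rank_determined detq.
move=> estep.
apply: (@lt_le_trans _ _ ((1 - m.+2%:R^-1) * \int[P]_w (\1_(A m.+1) w : R))).
  by rewrite mulr_gt0// subr_gt0 invf_lt1// ltr1n.
have bL n := @bounded_measurable_num_retained _ _ _ _ X p n.
(* The integrand is 1 exactly when the list has one item and the next is rejected; written this way
   it is affine in the increment, as [Rintegral_step] requires. *)
apply: (@le_trans _ _
    (\int[P]_w (\1_(A m.+1) w + - \1_(A m.+1) w * (L m.+2 w - L m.+1 w)))); last first.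
  apply: Rintegral_bm_le.
  - apply: bounded_measurableD => //; apply: bounded_measurableM => //.
    exact: bounded_measurableB.
  - exact: b1.
  - move=> w; rewrite !indicE; case: (boolP (w \in A m.+1)) => [|_]; last first.
      by rewrite mulr0n oppr0 mul0r addr0 ler0n.
    rewrite inE /A/= => L1; rewrite L1 mulN1r.
    have LE : L m.+2 w = 1 +
        (rank (path w) m.+2 m.+1 <= quota p (retained p (path w) m.+1))%N%:R.
      by rewrite [LHS]/num_retained retainedS// natrD; congr (_ + _); exact: L1.
    rewrite LE [1 + _]addrC addrK; case: (_ <= _)%N LE => LE.
      by rewrite subrr ler0n.
    by rewrite subr0 mem_set//= LE addr0.
rewrite estep -Rintegral_bmZ//.
apply: Rintegral_bm_le.
- by apply: bounded_measurableM => //; exact: bounded_measurable_cst.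
- by apply: bounded_measurableD => //; exact: bounded_measurableM.
- move=> w; rewrite !indicE; case: (boolP (w \in A m.+1)) => [|_]; last first.
    by rewrite mulr0n mulr0 oppr0 mul0r addr0.
  rewrite inE /A/= /num_retained => /eqP; rewrite pnatr_eq1 => /eqP L1.
  rewrite mulr1 mulN1r lerB// /retention_rate L1.
  rewrite -[leRHS]mul1r ler_wpM2r ?invr_ge0// (ler_nat _ _ 1%N).
  exact: quota_leq.
Qed.

End Limit.

(** * Identification and nondegeneracy of the limit *)

Local Open Scope ereal_scope.

Theorem theorem4p3 (d : measure_display) (T : measurableType d) (R : realType)
    (P : probability T R) (X : nat -> {RV P >-> R}) (p : R)
    (indepX : mutually_independent X)
    (idX : identically_distributed X)
    (contX : forall i, continuous (cdf (X i)))
    (p_gt0 : (0 < p)%R) (p_le1 : (p <= 1)%R) :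
  let L := num_retained p X in
  let M := fun n w => (L n w / n.+1%:R `^ p)%R in
  submartingale P (fun n => rank_field X n.+1) (fun n => M n.+1) /\
  exists (Lambda : {RV P >-> R}) (c : R),
    [/\ {ae P, forall w, (M n w @[n --> \oo] --> Lambda w)%R},
        not_ae_constant P Lambda,
        ('E_P[L n] * ((n%:R `^ p)^-1)%:E) @[n --> \oo] --> c%:E /\ (0 < c)%R,
        'E_P[M n] @[n --> \oo] --> 'E_P[Lambda] &
        'E_P[Lambda] = c%:E].
Proof.
move=> L M; split; first exact: submartingale_num_retained.
have p_ge0 := ltW p_gt0.
have p01 : (0 <= p <= 1)%R by rewrite p_ge0.
have [e e_gt0 growth_e] := growth_polynomial p_gt0 p_le1.
have [theta theta_gt0 cvg_theta] := mean_cvg indepX idX contX p_gt0 p_le1.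
have [g g_gt0 cvg_g] := growth_ratio_cvg p01.
have b_gt0 n : (0 < growth p n)%R := growth_gt0 n p_ge0.
pose Lambda : {RV P >-> R} := mfun_Sub (mem_set (measurable_limit_ratio X p)).
pose s k := ((k.+2 ^ e).-1).
have s_cvg (u : nat -> R) (l : R) : (u n @[n --> \oo] --> l)%R ->
    (u (s k) @[k --> \oo] --> l)%R by exact: times_cvg.
have bL n : bounded_measurable (L n) by exact: bounded_measurable_num_retained.
have bM n : bounded_measurable (M n) by exact: bounded_measurable_M.
have meanM n : (\int[P]_w M n w = \int[P]_w L n w / growth p n * growth_ratio p n)%R.
  rewrite /growth_ratio mulrA divfK ?gt_eqF// [RHS]mulrC -Rintegral_bmZ//.
  by apply: eq_Rintegral => w _; rewrite mulrC.
pose c := (theta * g)%R.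
have c_gt0 : (0 < c)%R by rewrite mulr_gt0.
have cvg_c : (\int[P]_w M n w @[n --> \oo] --> c)%R.
  rewrite (_ : (fun n => _) = fun n =>
    (\int[P]_w L n w / growth p n * growth_ratio p n)%R); first exact: cvgM.
  by apply/funext.
have wcvg := weighted_mean_cvg indepX idX contX p_gt0 p_le1 e_gt0 growth_e.
have indicT w : (\1_[set: T] w = 1 :> R)%R by rewrite indicE in_setT.
have iLambda : P.-integrable [set: T] (EFin \o Lambda).
  have [iL _] := wcvg _ measurableT.
  by apply: eq_integrable iL => // w _; rewrite indicT mul1r.
(* The means of [M] already converge to [c]; dominated convergence along [s] identifies [c] as the
   mean of [Lambda]. *)
have meanLambda : (\int[P]_w Lambda w = c)%R.
  have [_ cvL] := wcvg _ measurableT.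
  apply: (cvg_unique _ _ (s_cvg _ _ cvg_c)) => //.
  have -> : (\int[P]_w Lambda w = \int[P]_w (\1_[set: T] w * limit_ratio X p w))%R.
    by apply: eq_Rintegral => w _; rewrite indicT mul1r.
  rewrite (_ : (fun k => _) = fun k => (\int[P]_w (\1_[set: T] w * M (s k) w))%R).
    exact: cvL.
  by apply/funext => k; apply: eq_Rintegral => w _; rewrite indicT mul1r.
have ELambda : 'E_P[Lambda] = c%:E.
  rewrite unlock -meanLambda /Rintegral fineK//.
  exact: integrable_fin_num.
exists Lambda, c; split => //.
- exact: (ae_ratio_cvg indepX idX contX p_gt0 p_le1 e_gt0 growth_e).
- move=> [c0 Lambda_c0].
  have const (A : set T) : measurable A ->
      (\int[P]_w (\1_A w * limit_ratio X p w) = c0 * \int[P]_w (\1_A w : R))%R.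
    move=> mA; have bA := bounded_measurable_indic R mA.
    rewrite -Rintegral_bmZ// /Rintegral; congr fine; apply: ae_eq_integral => //.
    + apply/measurable_EFinP; apply: measurable_funM; first by case: bA.
      exact: measurable_limit_ratio.
    + apply/measurable_EFinP; apply: measurable_funM => //; by case: bA.
    + move: Lambda_c0; apply: filterS => w /= h _; congr (_%:E).
      by rewrite mulrC; congr (_ * _)%R.
  have c0E : c0 = c.
    have := const _ measurableT.
    have -> : (\int[P]_w (\1_[set: T] w : R) = 1)%R.
      by rewrite -[RHS](Rintegral_bm_cst P); apply: eq_Rintegral => w _.
    rewrite mulr1 => <-; rewrite -meanLambda.
    by apply: eq_Rintegral => w _; rewrite indicT mul1r.
  (* If [Lambda] is constant, its mean on the event [A] that one item is retained at time [s k] is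
     [c * P A]. The supermartingale started there bounds it by [(1 + 1 / p) * P A * g / b (s k)].
     Dividing by [P A > 0] and using [b (s k) >= (k + 2)^4 >= k] gives the claim, absurd for large
     [k]. *)
  have small k : (c * k%:R <= (1 + p^-1) * g)%R.
    pose A : set T := [set w | L (s k) w = 1%R].
    have sk_gt0 : (0 < s k)%N by exact: times_gt0 growth_e _.
    have detA : rank_determined X (s k) A.
      move=> w w' /(num_retained_determined p (leqnn _)) h.
      by apply/propext; rewrite /A /mkset /L h.
    have mA := measurable_rank_determined detA.
    have bA := bounded_measurable_indic R mA.
    set a := (\int[P]_w (\1_A w : R))%R.
    have a_gt0 : (0 < a)%R by exact: probability_one_retained.
    have det1 : rank_determined X (s k) (fun w => \1_A w : R).
      move=> w w' /detA h; rewrite !indicE.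
      by have -> : (w \in A) = (w' \in A) by apply/idP/idP; rewrite !inE h.
    have upper n : (s k <= n)%N ->
        (\int[P]_w (\1_A w * M n w) <=
         (1 + p^-1) * a / growth p (s k) * growth_ratio p n)%R.
      move=> kn; have kn' : (0 < s k <= n)%N by rewrite sk_gt0.
      have det0 w : (0 <= \1_A w :> R)%R by rewrite indicE ler0n.
      have := weighted_mean_upper indepX idX contX p_gt0 p_le1 kn' det1 det0.
      have -> : (\int[P]_w (\1_A w * (num_retained p X (s k) w + p^-1)) =
          (1 + p^-1) * a)%R.
        rewrite -Rintegral_bmZ//; apply: eq_Rintegral => w _.
        rewrite [RHS]mulrC !indicE; case: (boolP (w \in A)) => [|_]; last by rewrite !mul0r.
        by rewrite inE /A/= /L => ->.
      move=> h; have r0 := ltW (growth_ratio_gt0 n p_ge0).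
      apply: le_trans (ler_wpM2r r0 h).
      rewrite /growth_ratio mulrA divfK ?gt_eqF//.
      rewrite [leRHS]mulrC -Rintegral_bmZ; last first.
        apply: bounded_measurableM => //; apply: bounded_measurableD => //.
        exact: bounded_measurable_cst.
      apply: Rintegral_bm_le; first exact: bounded_measurableM.
        apply: bounded_measurableM; first exact: bounded_measurable_cst.
        apply: bounded_measurableM => //; apply: bounded_measurableD => //.
        exact: bounded_measurable_cst.
      move=> w; rewrite /M mulrCA mulrA [leRHS]mulrC ler_wpM2r ?invr_ge0 ?powR_ge0//.
      rewrite mulrC; apply: ler_wpM2l => //.
      by rewrite lerDl invr_ge0.
    have [_ cvA] := wcvg _ mA.
    have cvr : ((1 + p^-1) * a / growth p (s k) * growth_ratio p (s j) @[j --> \oo]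
        --> (1 + p^-1) * a / growth p (s k) * g)%R.
      by apply: cvgM; [exact: cvg_cst|exact: s_cvg].
    have le_lim : (c * a <= (1 + p^-1) * a / growth p (s k) * g)%R.
      rewrite -c0E -const//.
      apply: (ler_cvg_to cvA cvr); exists k => // j /= kj.
      apply: upper; rewrite leq_eqVlt in kj; case/predU1P: kj => [->//|kj].
      exact: ltnW (times_homo e_gt0 kj).
    have : (c <= (1 + p^-1) * g / growth p (s k))%R.
      rewrite -(ler_pM2r a_gt0); apply: le_trans le_lim _.
      by rewrite le_eqVlt; apply/orP; left; apply/eqP; ring.
    rewrite ler_pdivlMr//; apply: le_trans; rewrite ler_wpM2l// ?(ltW c_gt0)//.
    apply: le_trans (growth_e k); rewrite -natrX ler_nat.
    apply: (@leq_trans k.+2); first by rewrite !leqW.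
    by rewrite -{1}(expn1 k.+2) leq_exp2l.
  have [N cN] : exists N : nat, ((1 + p^-1) * g / c < N%:R)%R.
    by exists (Num.truncn ((1 + p^-1) * g / c)).+1; exact: truncnS_gt.
  by move: cN; rewrite ltr_pdivrMr// [ltRHS]mulrC ltNge small.
- split=> //; apply: cvg_EFin.
    apply: nearW => n; rewrite expectation_bounded_measurable//.
  rewrite (_ : _ \o _ = fun n => (\int[P]_w L n w * (n%:R `^ p)^-1)%R); last first.
    by apply/funext => n /=; rewrite expectation_bounded_measurable.
  (* The shift avoids the zero denominator at [n = 0]; what remains is [E M_(n+1)] times
     [((n + 2) / (n + 1))^p], a factor tending to 1. *)
  rewrite -cvg_shiftS -[c]mulr1.
  rewrite (_ : [sequence _]_n = fun n => (\int[P]_w M n.+1 w *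
      (n.+2%:R `^ p / n.+1%:R `^ p))%R); last first.
    apply/funext => n.
    have -> : (\int[P]_w M n.+1 w = \int[P]_w L n.+1 w / n.+2%:R `^ p)%R.
      by rewrite meanM /growth_ratio mulrA divfK ?gt_eqF.
    by rewrite mulrA divfK// gt_eqF// powR_gt0.
  apply: cvgM; first by rewrite -cvg_shiftS in cvg_c.
  apply: (@powR_ratio_cvg1 _ _ (fun n => n.+2%:R) (fun n => n.+1%:R)) => //.
    by move=> n; rewrite ltr0Sn ler_nat leqnSn.
  rewrite (_ : (fun n => _) = fun n => (1 + n.+1%:R^-1)%R); last first.
    by apply/funext => n; rewrite -(natr1 n.+1) mulrDl divff// mul1r.
  rewrite -[X in _ --> X]addr0; apply: cvgD; first exact: cvg_cst.
  exact: cvg_harmonic.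
- rewrite ELambda; apply: cvg_EFin.
    by apply: nearW => n; rewrite expectation_bounded_measurable.
  rewrite (_ : _ \o _ = fun n => (\int[P]_w M n w)%R)//.
  by apply/funext => n /=; rewrite expectation_bounded_measurable.
Qed.
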